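(* Given a connected graph $G$ of order $n$ and size $m$, one can construct in time $O(m\log n)$ an additive tree $O\big(\mathrm{tb}(G)\log n\big)$-spanner of $G$.
   Context: All graphs are finite, simple, and undirected. The order and size of $G$ are its numbers of vertices and edges. $d_G(u,v)$ denotes the distance in $G$ between vertices $u$ and $v$. The constants hidden in the $O(\cdot)$ notation are absolute. For a (non-empty) set $U$ of vertices of a connected graph $G$, the radius of $U$ in $G$ is $\mathrm{rad}_G(U)=\min\{\max\{d_G(u,v):v\in U\}:u\in V(G)\}$; the center $u$ need not belong to $U$, and distances are taken in $G$. A tree decomposition of $G$ is a pair $\left(T,(X_t)_{t\in V(T)}\right)$, where $T$ is a tree and each $X_t$ (the bag of $t$) is a set of vertices of $G$, such that (1) for every vertex $u$ of $G$, the set $\{t\in V(T):u\in X_t\}$ induces a non-empty subtree of $T$, and (2) for every edge $uv$ of $G$, some bag $X_t$ contains both $u$ and $v$. Its breadth is $\max\{\mathrm{rad}_G(X_t):t\in V(T)\}$. The tree breadth $\mathrm{tb}(G)$ of a connected graph $G$ is the minimum breadth of a tree decomposition of $G$. For a non-negative integer $k$, an additive tree $k$-spanner of $G$ is a spanning tree $S$ of $G$ such that $d_S(u,v)\leq d_G(u,v)+k$ for every two vertices $u$ and $v$ of $G$. *)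

(* Defs.v *)
From HB Require Import structures.
From mathcomp Require Import all_boot.
From mathcomp Require Import boolp.

Set Implicit Arguments.
Unset Strict Implicit.
Unset Printing Implicit Defensive.

(** * Graphs *)

Section Graphs.
Variable T : finType.
Implicit Types (e S : rel T) (U : {set T}).

Definition simple_graph e := symmetric e /\ irreflexive e.

Definition connected_graph e := 0 < #|T| /\ forall x y, connect e x y.

(* A uniq cyclic sequence of at most two vertices is a vertex or an edge
   traversed back and forth, not a cycle of the graph. *)
Definition acyclic_graph e := forall p : seq T, ucycle e p -> size p <= 2.

Definition is_tree e :=
  [/\ simple_graph e, connected_graph e & acyclic_graph e].

Definition edge_set e : {set {set T}} :=
  [set [set p.1; p.2] | p : T * T & e p.1 p.2].

Definition graph_size e := #|edge_set e|.

(* The least length of a walk from x to y. In a connected graph it is less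
   than #|T|; the junk value #|T| is returned when there is no walk. *)
Definition dist e (x y : T) : nat :=
  find (fun k => [exists p : k.-tuple T, path e x p && (last x p == y)])
       (iota 0 #|T|).

(* #|T| bounds all values of [dist], hence is a harmless default for the
   minimum. The empty set gets radius 0. *)
Definition radius e U : nat :=
  \big[minn/#|T|]_(u : T) \max_(v in U) dist e u v.

Definition induced e U : rel {x : T | x \in U} :=
  fun x y => e (val x) (val y).

Definition additive_tree_spanner e S (k : nat) :=
  [/\ is_tree S, subrel S e & forall u v, dist S u v <= dist e u v + k].

End Graphs.

Section TreeBreadth.
Variables (V : finType) (e : rel V).

Definition tree_decomposition (I : finType) (tr : rel I) (X : I -> {set V}) :=
  [/\ is_tree tr,
      forall u, is_tree (@induced I tr [set i | u \in X i])
    & forall u v, e u v -> exists i, (u \in X i) && (v \in X i)].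

Definition breadth (I : finType) (X : I -> {set V}) : nat :=
  \max_(i : I) radius e (X i).

Definition has_decomposition_of_breadth (b : nat) : Prop :=
  exists (I : finType) (tr : rel I) (X : I -> {set V}),
    tree_decomposition tr X /\ breadth X = b.

Lemma one_vertex_tree (I : finType) (tr : rel I) :
  #|I| = 1 -> irreflexive tr -> is_tree tr.
Proof.
move=> I1 irr; have eqI (x y : I) : x = y.
  by have /fintype_le1P/(_ x y) : #|I| <= 1 by rewrite I1.
split; [split=> // x y; by rewrite (eqI x y)|split; first by rewrite I1|].
- by move=> x y; rewrite (eqI x y).
- by move=> [|x [|y [|z p]]] //; rewrite (eqI y x) /ucycle /= inE eqxx !andbF.
Qed.

Lemma has_decomposition : exists b, `[< has_decomposition_of_breadth b >].
Proof.
pose X (_ : unit) := [set: V].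
exists (breadth X); apply/asboolP.
exists unit, (fun _ _ => false), X; split=> //; split.
- by apply: one_vertex_tree; rewrite ?card_unit.
- move=> u; apply: one_vertex_tree => //.
  by rewrite card_sig -card_unit; apply: eq_card => x; rewrite !inE.
- by move=> u v _; exists tt; rewrite !inE.
Qed.

Definition tree_breadth : nat := ex_minn has_decomposition.

End TreeBreadth.

(** * Random access machine

  A program is a fixed piece of structured code, using finitely many scalar
  variables and finitely many arrays (both named by numerals occurring in the
  code), with indirect access to array cells. Each operation takes unit time.
  The machine has [w]-bit words: [exec w c s t s'] holds when [c], started in
  [s], halts in [s'] after [t] elementary steps, and no constant or sum met
  along the way reaches [2 ^ w]; an overflowing run is stuck. The other
  operations never return a value exceeding all those they read and 1, so an
  execution only handles integers that are below [2 ^ w] or bounded by some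
  number of the initial state. *)

Inductive expr :=
  | Const of nat
  | Var of nat
  | Get of nat & expr
  | Add of expr & expr
  | Sub of expr & expr
  | Lt of expr & expr
  | Eq of expr & expr.

Inductive cmd :=
  | Skip
  | Assign of nat & expr
  | Put of nat & expr & expr
  | Seq of cmd & cmd
  | If of expr & cmd & cmd
  | While of expr & cmd.

Record state := State { var : nat -> nat; arr : nat -> nat -> nat }.

Definition upd (A : Type) (f : nat -> A) (i : nat) (a : A) : nat -> A :=
  fun j => if j == i then a else f j.

Definition set_var (s : state) x v := State (upd (var s) x v) (arr s).

Definition set_arr (s : state) a i v :=
  State (var s) (upd (arr s) a (upd (arr s a) i v)).

Definition fit (w v : nat) : option nat := if v < 2 ^ w then Some v else None.

Fixpoint eval (w : nat) (s : state) (x : expr) : option nat :=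
  let binop f x1 x2 :=
    if eval w s x1 is Some v1 then
      if eval w s x2 is Some v2 then f v1 v2 else None
    else None in
  match x with
  | Const k => fit w k
  | Var i => Some (var s i)
  | Get a x1 => if eval w s x1 is Some i then Some (arr s a i) else None
  | Add x1 x2 => binop (fun v1 v2 => fit w (v1 + v2)) x1 x2
  | Sub x1 x2 => binop (fun v1 v2 => Some (v1 - v2)) x1 x2
  | Lt x1 x2 => binop (fun v1 v2 => Some (nat_of_bool (v1 < v2))) x1 x2
  | Eq x1 x2 => binop (fun v1 v2 => Some (nat_of_bool (v1 == v2))) x1 x2
  end.

Fixpoint cost (x : expr) : nat :=
  match x with
  | Const _ | Var _ => 1
  | Get _ x1 => (cost x1).+1
  | Add x1 x2 | Sub x1 x2 | Lt x1 x2 | Eq x1 x2 => (cost x1 + cost x2).+1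
  end.

Inductive exec (w : nat) : cmd -> state -> nat -> state -> Prop :=
  | ExecSkip s : exec w Skip s 1 s
  | ExecAssign s i x v : eval w s x = Some v ->
      exec w (Assign i x) s (cost x).+1 (set_var s i v)
  | ExecPut s a x y i v : eval w s x = Some i -> eval w s y = Some v ->
      exec w (Put a x y) s (cost x + cost y).+1 (set_arr s a i v)
  | ExecSeq c1 c2 s t1 s1 t2 s2 : exec w c1 s t1 s1 -> exec w c2 s1 t2 s2 ->
      exec w (Seq c1 c2) s (t1 + t2) s2
  | ExecIf x c1 c2 s v t s1 : eval w s x = Some v ->
      exec w (if v != 0 then c1 else c2) s t s1 ->
      exec w (If x c1 c2) s (cost x + t).+1 s1
  | ExecWhileEnd x c s : eval w s x = Some 0 ->
      exec w (While x c) s (cost x).+1 s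
  | ExecWhileStep x c s v t1 s1 t2 s2 : eval w s x = Some v -> v != 0 ->
      exec w c s t1 s1 -> exec w (While x c) s1 t2 s2 ->
      exec w (While x c) s (cost x + t1 + t2).+1 s2.

(** * Input and output of graph algorithms *)

Definition adjacency_lists n (e : rel 'I_n) (adj : 'I_n -> seq 'I_n) :=
  forall u, uniq (adj u) /\ forall v, (v \in adj u) = e u v.

(* Variable 0 contains n. The concatenation of the adjacency lists of
   0, ..., n - 1 is in array 1, and the neighbours of u occupy there the cells
   from arr 0 u (included) to arr 0 u.+1 (excluded). All the rest is 0. *)
Definition input_state n (adj : 'I_n -> seq 'I_n) : state :=
  let lists := [seq [seq val v | v <- adj u] | u <- enum 'I_n] in
  State (fun x => if x == 0 then n else 0)
        (fun a => match a with
                  | 0 => nth 0 (0 :: scanl addn 0 (map size lists))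
                  | 1 => nth 0 (flatten lists)
                  | _ => fun=> 0
                  end).

(* The graph with the n - 1 edges whose ends are stored in arrays 2 and 3. *)
Definition output_graph n (s : state) : rel 'I_n :=
  let edges := [seq (arr s 2 i, arr s 3 i) | i <- iota 0 n.-1] in
  fun u v => ((val u, val v) \in edges) || ((val v, val u) \in edges).

(* Main.v *)
Require Import Defs.
From mathcomp Require Import all_boot.
From mathcomp Require Import boolp zify.

Set Implicit Arguments.
Unset Strict Implicit.
Unset Printing Implicit Defensive.

(** Fix a breadth-first search tree and its levels. A cluster is the set of the
  vertices of some level l in one component of the graph induced by the levels
  at least l; by the Helly property of subtrees of a tree decomposition, its
  vertices are at distance at most 6 tb(G).

  Let F be a set of edges of the search tree, at most one going up from each
  cluster. A simple path from u to v with k edges outside F has length at most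
  d(u, v) + 2k: the edges that go up from a cluster form a cut, which a closed
  walk crosses an even number of times. Hence the shortest path tree for the
  lengths 0 on F and 1 outside F is an additive spanner, provided that every
  vertex is at distance O(tb(G) log n) from the root for these lengths.

  F is obtained by union-find by size, adding the vertices in the reverse search
  order. Each class keeps a representative on its top level, which moves up to
  its parent through a new edge of F. When two classes are merged, the
  representative of the smaller one is abandoned for the other one, which lies
  in the same cluster, so that each vertex pays 6 tb(G) at most log n times. *)

(** * Walks and subtrees *)

(** The program never sees a tree decomposition: the breadth enters only the analysis, as a bound on
    the diameter of the clusters. The reverse search order controls the levels of the
    representatives. A new vertex of level l only meets classes whose representative is at level l
    or l + 1: if it were deeper, its parent would already be processed and would have replaced it. A
    representative at level l + 1 is lifted just before merging, so two merged representatives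
    always share a level and a cluster. Both searches run the same code, first with no edge of
    length 0. A single queue with two scan pointers handles the lengths 0 and 1, because edges of
    length 1 are followed only when no scan for length 0 is pending. The final constant is 24 = 4 *
    6: each of the two walks to the root has at most 6 tb(G) log n edges outside F, and the cut
    argument doubles their total. *)

Fixpoint esum (T : Type) (f : T -> T -> nat) (x : T) (p : seq T) : nat :=
  if p is y :: p' then f x y + esum f y p' else 0.

Definition indic (T : Type) (f : rel T) (x y : T) : nat := f x y.

Section Walks.
Variable T : eqType.
Implicit Types (e : rel T) (f g : T -> T -> nat) (x y : T) (p q : seq T).

Lemma esum_cat f x p q : esum f x (p ++ q) = esum f x p + esum f (last x p) q.
Proof. by elim: p x => //= y p IH x; rewrite IH addnA. Qed.

Lemma leq_esum e f g x p :
  (forall a b, e a b -> f a b <= g a b) -> path e x p -> esum f x p <= esum g x p.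
Proof.
by move=> fg; elim: p x => //= y p IH x /andP[/fg ? /IH]; apply: leq_add.
Qed.

Lemma esumD f g x p :
  esum (fun a b => f a b + g a b) x p = esum f x p + esum g x p.
Proof. by elim: p x => //= y p IH x; rewrite IH addnACA. Qed.

Lemma esum1 x p : esum (fun _ _ => 1) x p = size p.
Proof. by elim: p x => //= y p IH x; rewrite IH. Qed.

Lemma esum_sum (I : Type) (r : seq I) (P : pred I) (F : I -> T -> T -> nat) x p :
  \sum_(i <- r | P i) esum (F i) x p
    = esum (fun a b => \sum_(i <- r | P i) F i a b) x p.
Proof.
elim: p x => [|y p IH] x /=; first by rewrite big1.
by rewrite big_split /= IH.
Qed.

(** Cutting a loop only drops nonnegative terms, so the same shortening serves lengths and numbers
    of non-free edges. *)
Lemma uniq_walk e f x p : path e x p ->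
  exists q, [/\ path e x q, last x q = last x p, uniq (x :: q)
             & esum f x q <= esum f x p].
Proof.
elim: p x => [|y p IH] x /=; first by exists [::].
case/andP=> exy /IH[q [eq lq uq fq]].
have [xq|xq] := boolP (x \in y :: q); last first.
  exists (y :: q); rewrite /= exy eq lq; split=> //; last by rewrite leq_add2l.
  by rewrite /= in uq; rewrite uq andbT.
have : path e x (y :: q) by rewrite /= exy.
rewrite -lq; have -> : last y q = last x (y :: q) by [].
have : esum f x (y :: q) <= f x y + esum f y p by rewrite /= leq_add2l.
move: uq; case/splitPr: xq => q1 q2 uq le1.
rewrite last_cat cat_path /= => /and3P[_ _ pq2]; exists q2; split=> //.
  by move: uq; rewrite cat_uniq => /and3P[].
by apply: leq_trans le1; rewrite esum_cat /= addnA leq_addl.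
Qed.

End Walks.

Definition within (T : Type) (e : rel T) (A : pred T) : rel T :=
  fun x y => [&& e x y, A x & A y].

(** * The Helly property of three subtrees *)

Section Subtrees.
Variables (I : finType) (tr : rel I).
Hypotheses (tr_sym : symmetric tr) (tr_acyc : acyclic_graph tr).

Definition connected_in (A : pred I) :=
  forall x y, A x -> A y -> connect (within tr A) x y.

Lemma connect_within_sub (A B : pred I) x y :
  (forall i, A i -> B i) -> connect (within tr A) x y -> connect (within tr B) x y.
Proof.
move=> AB; apply: connect_sub => a b /and3P[ab Aa Ab].
by apply: connect1; rewrite /within ab !AB.
Qed.

Lemma connected_inU (A B : pred I) k : connected_in A -> connected_in B ->
  A k -> B k -> connected_in (predU A B).
Proof.
move=> cA cB Ak Bk.
have to_k x : predU A B x -> connect (within tr (predU A B)) x k.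
  case/orP=> [Ax|Bx].
    by apply: connect_within_sub (cA _ _ Ax Ak) => i /= ->.
  by apply: connect_within_sub (cB _ _ Bx Bk) => i /= ->; rewrite orbT.
have sym : symmetric (within tr (predU A B)).
  by move=> a b; rewrite /within tr_sym (andbC (predU A B a)).
move=> x y /to_k xk /to_k; rewrite (sym_connect_sym sym).
exact: connect_trans.
Qed.

(** Take a shortest walk inside [B] from [A] to [C]. Unless it is a single vertex, a return from [C]
    to [A] through [z], inside the union of [A] and [C], closes it into a cycle of the tree. *)
Lemma helly3 (A B C : pred I) x y z :
    connected_in A -> connected_in B -> connected_in C ->
    A x -> B x -> B y -> C y -> A z -> C z ->
  exists t, [/\ A t, B t & C t].
Proof.
move=> cA cB cC Ax Bx By Cy Az Cz.
pose good m := exists s p, [/\ A s, C (last s p), B s, path (within tr B) s p & size p = m].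
have good_ex : exists m, `[< good m >].
  have /connectP[p pp yE] := cB _ _ Bx By.
  by exists (size p); apply/asboolP; exists x, p; rewrite -yE.
case: (ex_minnP good_ex) => m /asboolP[s [p [As Cl Bs]]].
case/(uniq_walk (fun _ _ => 1)) => p' [pp' lp' up' le_p'] sp.
rewrite !esum1 sp in le_p' => minm; rewrite -lp' in Cl.
have {minm} min s' q' : A s' -> C (last s' q') -> B s' ->
    path (within tr B) s' q' -> size p' <= size q'.
  move=> *; apply: leq_trans le_p' _; apply: minm; apply/asboolP.
  by exists s', q'.
have [t|/eqP ns] := eqVneq p' [::]; first by exists s; move: Cl; rewrite t.
have Bp t : t \in p' -> B t.
  elim: (p') (s) pp' => //= a q IH b /andP[/and3P[_ _ Ba] /IH {}IH].
  by rewrite inE => /predU1P[->|/IH].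
have nAp t : t \in p' -> ~~ A t.
  move=> tp; apply/negP=> At; have Bt := Bp _ tp.
  move: tp pp' Cl min; case/splitPr=> q1 q2.
  rewrite cat_path last_cat /= => /and3P[_ _ pq2] Cl min.
  by have := min t q2 At Cl Bt pq2; rewrite size_cat addnS ltnNge leq_addl.
have nCp t : t \in belast s p' -> ~~ C t.
  move=> tp; apply/negP=> Ct; move: tp ns pp' Cl min up'.
  case/lastP: p' {nAp Bp lp' le_p'} => [|q w] // tp _ pp' Cl min up'.
  rewrite belast_rcons in tp; move: pp'; rewrite rcons_path => /andP[pq _].
  move: tp; rewrite inE => /predU1P[tE|tq].
    move: Ct; rewrite tE => Cs.
    by have := min s [::] As Cs Bs isT; rewrite size_rcons.
  move: tq pq min; case/splitPr=> q1 q2; rewrite -cat_rcons cat_path => /andP[pq1 _] min.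
  have := min s (rcons q1 t) As; rewrite last_rcons => /(_ Ct Bs pq1).
  by rewrite !size_rcons size_cat size_rcons !addSn !ltnS ltnNge leq_addr.
set y' := last s p' in Cl; pose e' := relU (within tr A) (within tr C).
have e'tr : subrel e' tr by move=> a b /orP[] /and3P[].
have : connect e' y' s.
  apply: (@connect_trans _ _ z).
    apply: connect_sub (cC _ _ Cl Cz) => a b ab; apply: connect1.
    by rewrite /= ab orbT.
  by apply: connect_sub (cA _ _ Az As) => a b ab; apply: connect1; rewrite /= ab.
case/connectP=> q0 /(uniq_walk (fun _ _ => 1)) [q [pq lq uq _]] s_q0.
rewrite -s_q0 in lq; have y'p : y' \in p'.
  by move: ns; rewrite /y'; case: (p') => //= a l _; rewrite mem_last.
have ny' : ~~ A y' by apply: nAp.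
have ns' : ~~ C s by apply: nCp; case: (p') ns => //= a l _; rewrite inE eqxx.
case/lastP: q lq pq uq => [sy|q w]; first by rewrite -sy /= in As; rewrite As in ny'.
rewrite last_rcons => ->; rewrite rcons_path => /andP[pq elast] uq.
have ACq t : t \in q -> A t || C t.
  elim: (q) (y') pq => //= a r IH b /andP[eab /IH {}IH].
  rewrite inE => /predU1P[->|/IH //].
  by case/orP: eab => /and3P[_ _ ->]; rewrite ?orbT.
(* By minimality [p'] avoids [A], and it avoids [C] except at its end, whereas [q] stays in the
   union of [A] and [C]; hence the two are disjoint. *)
have ucyc : ucycle tr (s :: p' ++ q).
  rewrite /ucycle /= rcons_cat cat_path; apply/andP; split.
    apply/andP; split; first by apply: sub_path pp' => a b /and3P[].
    by rewrite rcons_path -/y' (sub_path e'tr pq) e'tr.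
  have : uniq ((s :: p') ++ q); last by [].
  rewrite cat_uniq up' /=.
  move: uq => /=; rewrite rcons_uniq mem_rcons inE negb_or => /andP[/andP[nsy nyq] /andP[nsq ->]].
  rewrite andbT; apply/hasPn=> t tq; rewrite /= inE negb_or.
  apply/andP; split; first by apply: contraNneq nsq => <-.
  apply/negP=> tp; have nAt := nAp _ tp.
  have := ACq _ tq; rewrite (negPf nAt) /= => Ct.
  suff /nCp : t \in belast s p' by rewrite Ct.
  have : t \in s :: p' by rewrite inE tp orbT.
  rewrite lastI mem_rcons inE => /predU1P[tE|//].
  by rewrite -/y' in tE; rewrite -tE tq in nyq.
(* Only an edge traversed back and forth remains, between [s] and [y']. Its return lies in [A] or in
   [C], but [y'] is not in [A] and [s] is not in [C]. *)
have := tr_acyc ucyc; rewrite /= size_cat.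
case: (p') (erefl y') ns => [|a [|b l]] y'E //= _.
case: (q) elast => [|b l] //=.
by move=> /orP[] /and3P[_ Y S]; [rewrite Y in ny'|rewrite S in ns'].
Qed.

End Subtrees.

(** * Distances, layers and free edges *)

Section Distances.
Variables (V : finType) (e : rel V).

Lemma dist_le_card x y : dist e x y <= #|V|.
Proof. by rewrite -[leqRHS](size_iota 0) find_size. Qed.

Lemma dist_le x p : path e x p -> dist e x (last x p) <= size p.
Proof.
move=> pp; have [lt|ge] := ltnP (size p) #|V|; last first.
  exact: leq_trans (dist_le_card _ _) ge.
rewrite leqNgt; apply/negP=> lt_d.
have := before_find 0 lt_d; rewrite nth_iota // add0n => /negbT/negP[].
by apply/existsP; exists (in_tuple p); rewrite pp eqxx.
Qed.

Lemma dist_walk x y : connect e x y ->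
  exists p, [/\ path e x p, last x p = y & size p = dist e x y].
Proof.
case/connectP=> p0 /shortenP[p pp up _] ->.
have lt_p : size p < #|V|.
  by rewrite -[_.+1]/(size (x :: p)) -(card_uniqP up) max_card.
have has_p : has (fun k => [exists q : k.-tuple V, path e x q && (last x q == last x p)])
  (iota 0 #|V|).
  apply/hasP; exists (size p); first by rewrite mem_iota.
  by apply/existsP; exists (in_tuple p); rewrite pp eqxx.
have lt_f : dist e x (last x p) < #|V|.
  by rewrite -[ltnRHS](size_iota 0) -has_find.
have := nth_find 0 has_p; rewrite nth_iota //.
rewrite add0n => /existsP[q /andP[pq /eqP lq]].
by exists q; rewrite pq lq size_tuple.
Qed.

(** The minimum is attained at a vertex or is the default [#|V|]; in the latter case [u0] serves as
    centre, since no distance exceeds [#|V|]. *)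
Lemma radiusP (U : {set V}) (u0 : V) :
  exists c, forall v, v \in U -> dist e c v <= radius e U.
Proof.
rewrite /radius; elim/big_ind: _ => [|m1 m2 [c1 h1] [c2 h2]|c _].
- by exists u0 => v _; apply: dist_le_card.
- by case: (leqP m1 m2) => _; [exists c1|exists c2].
- by exists c => v vU; apply: (bigmax_sup v).
Qed.

Hypotheses (e_sym : symmetric e) (e_conn : forall x y, connect e x y).

Lemma sym_walk x p : path e x p ->
  exists q, [/\ path e (last x p) q, last (last x p) q = x & size q = size p].
Proof.
elim: p x => [|y p IH] x /=; first by exists [::].
case/andP=> exy /IH[q [pq lq sq]]; exists (rcons q x).
by rewrite rcons_path pq lq last_rcons size_rcons sq e_sym.
Qed.

Lemma bag_walk (U : {set V}) u v : u \in U -> v \in U ->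
  exists p, [/\ path e u p, last u p = v & size p <= 2 * radius e U].
Proof.
have [c hc] := radiusP U u; move=> /hc du /hc dv.
have [p [pp lp sp]] := dist_walk (e_conn c u).
have [q [pq lq sq]] := dist_walk (e_conn c v).
have [r []] := sym_walk pp; rewrite lp => pr lr sr.
exists (r ++ q); rewrite cat_path last_cat lr pr pq; split=> //.
by rewrite size_cat mul2n -addnn leq_add // ?sr ?sp ?sq.
Qed.

End Distances.

(** * The diameter of the clusters *)

Section Decomposition.
Variables (V : finType) (e : rel V) (I : finType) (tr : rel I) (X : I -> {set V}).
Hypotheses (e_simple : simple_graph e) (e_conn : connected_graph e).
Hypothesis decX : tree_decomposition e tr X.

Let tr_sym : symmetric tr. Proof. by case: decX => [[[]]]. Qed.
Let tr_acyc : acyclic_graph tr. Proof. by case: decX => [[]]. Qed.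

Definition bags_meeting (s : seq V) : pred I := fun i => has (fun u => u \in X i) s.

Lemma connected_bags1 u : connected_in tr (fun i => u \in X i).
Proof.
have [_ /(_ u)[_ [_ cu] _] _] := decX => x y ux uy.
have ux' : x \in [set i | u \in X i] by rewrite inE.
have uy' : y \in [set i | u \in X i] by rewrite inE.
have /connectP[p] := cu (exist _ x ux') (exist _ y uy').
rewrite -[x]/(val (exist (fun i => i \in [set i | u \in X i]) x ux')).
move: (exist _ x ux') => a.
rewrite -[y in connect _ _ y]/(val (exist (fun i => i \in [set i | u \in X i]) y uy')).
move: (exist _ y uy') => b; elim: p a => [|c p IH] a /=; first by move=> _ ->.
case/andP=> ac /IH {}IH /IH; apply: connect_trans; apply: connect1.
rewrite /within [tr _ _]ac; have := valP a; have := valP c.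
by rewrite !inE => -> ->.
Qed.

(** Consecutive vertices of a walk share the bag of their edge, which glues their subtrees
    together. *)
Lemma connected_bags x p : path e x p -> connected_in tr (bags_meeting (x :: p)).
Proof.
elim: p x => [|y p IH] x /=.
  move=> _ i j; rewrite /bags_meeting /= !orbF => xi xj.
  apply: connect_within_sub (connected_bags1 xi xj) => k xk.
  by rewrite xk.
case/andP=> exy /IH cyp; case: decX => _ _ /(_ _ _ exy)[k /andP[xk yk]].
apply: (connected_inU tr_sym (@connected_bags1 x) cyp xk).
by rewrite /bags_meeting /= yk.
Qed.

Section Clusters.
Variables (r : V) (lev : V -> nat) (par : V -> V).
Hypothesis parP : forall x, x != r -> e x (par x) && (lev x == (lev (par x)).+1).
Hypothesis lev_lip : forall x y, e x y -> lev y <= (lev x).+1.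

Lemma lev_walk x p : path e x p -> lev (last x p) <= lev x + size p.
Proof.
elim: p x => [|y p IH] x /=; first by rewrite addn0.
by case/andP=> /lev_lip ly /IH /leq_trans; apply; rewrite addnS -addSn leq_add2r.
Qed.

(** Each step along parents loses exactly one level. The equality in the last clause lets
    [cluster_walk] turn level differences into lengths. *)
Lemma root_walk x : exists p, [/\ path e x p, last x p = r
  & forall a, a \in x :: p -> exists q, [/\ path e x q, last x q = a
      & lev x = lev a + size q]].
Proof.
have [n] := ubnP (lev x); elim: n x => // n IH x ltn.
have self : exists q, [/\ path e x q, last x q = x & lev x = lev x + size q].
  by exists [::]; rewrite addn0.
have [->|xr] := eqVneq x r.
  exists [::]; split=> // a; rewrite inE => /eqP->.
  by exists [::]; rewrite addn0.
have /andP[ex /eqP lx] := parP xr.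
case: (IH (par x)) => [|p [pp lp hp]]; first by rewrite -ltnS -lx.
exists (par x :: p); rewrite /= ex pp lp; split=> // a.
rewrite inE => /predU1P[->//|/hp[q [pq lq eq]]].
by exists (par x :: q); rewrite /= ex lx eq addnS.
Qed.

(* The bags meeting the tree paths from u and v to the root and those meeting
   a path from u to v above their level are three pairwise intersecting
   subtrees, and thus share a bag. *)
Lemma cluster_walk u v : lev u = lev v ->
    connect (within e (fun a => lev u <= lev a)) u v ->
  exists p, [/\ path e u p, last u p = v & size p <= 6 * breadth e X].
Proof.
move=> luv /connectP[p3 pp3 lp3].
have [p1 [pp1 lp1 h1]] := root_walk u; have [p2 [pp2 lp2 h2]] := root_walk v.
have /connected_bags c3 : path e u p3 by apply: sub_path pp3 => a b /and3P[].
have bag a : exists i, a \in X i.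
  case: decX => _ /(_ a)[_ [/card_gt0P[[i p] _]]].
  by exists i; move: p; rewrite inE.
have [x xr] := bag r; have [y yv] := bag v; have [z zu] := bag u.
have hl3 a : a \in u :: p3 -> lev u <= lev a.
  rewrite inE => /predU1P[->//|]; move: (lev u) pp3 => l.
  elim: (p3) (u) => //= b s IH w /andP[/and3P[_ _ wb] ps].
  by rewrite inE => /predU1P[->|] //; apply: IH ps.
have := helly3 tr_acyc (connected_bags pp1) (connected_bags pp2) c3.
move=> /(_ x y z); case.
- by apply/hasP; exists r => //; rewrite -lp1 mem_last.
- by apply/hasP; exists r => //; rewrite -lp2 mem_last.
- by apply/hasP; exists v => //; rewrite mem_head.
- by apply/hasP; exists v => //; rewrite lp3 mem_last.
- by apply/hasP; exists u => //; rewrite mem_head.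
- by apply/hasP; exists u => //; rewrite mem_head.
move=> t [/hasP[a a1 at_] /hasP[b b2 bt] /hasP[c /hl3 c3' ct]].
have le_t : 2 * radius e (X t) <= 2 * breadth e X.
  by rewrite leq_mul2l /breadth (bigmax_sup t).
have [e_sym _] := e_simple; have [_ econ] := e_conn.
have [q1 [pq1 lq1 sq1]] := h1 a a1.
have [q2 [pq2 lq2 sq2]] := h2 b b2.
have [q3 [pq3 lq3 sq3]] := bag_walk e_sym econ at_ bt.
have [q4 []] := sym_walk e_sym pq2; rewrite lq2 => pq4 lq4 sq4.
have [qa [/lev_walk]] := bag_walk e_sym econ at_ ct => la lqa sqa.
have [qb [/lev_walk]] := bag_walk e_sym econ bt ct => lb lqb sqb.
rewrite lqa in la; rewrite lqb in lb.
(* The common bag contains [c], of level at least [lev u], within twice the breadth of [a] and [b].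
   So the climbs [q1] and [q2] have length at most twice the breadth each, as has [q3] inside the
   bag; this is the 6. *)
exists (q1 ++ q3 ++ q4); rewrite !cat_path !last_cat lq1 lq3 pq1 pq3 pq4.
split=> //; rewrite !size_cat sq4.
move: (size q1) (size q2) (size q3) (size q4) (size qa) (size qb) (lev u) (lev v)
  (lev a) (lev b) (lev c) (radius _ _) (breadth _ _)
  luv c3' le_t sq1 sq2 sq3 sq4 la sqa lb sqb; clear; lia.
Qed.

End Clusters.
End Decomposition.

(** * Lengths of paths with free edges *)

Section FreeEdges.
Variables (V : finType) (e : rel V) (lev : V -> nat) (par : V -> V).
Variable F : pred V.
Hypothesis e_sym : symmetric e.
Hypothesis lev_lip : forall x y, e x y -> lev y <= (lev x).+1.
Hypothesis F_par : forall x, F x -> e x (par x) /\ lev x = (lev (par x)).+1.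

Definition above l : rel V := within e (fun a => l <= lev a).

Hypothesis F_uniq : forall x y,
  F x -> F y -> lev x = lev y -> connect (above (lev x)) x y -> x = y.

Definition free x y := (F x && (par x == y)) || (F y && (par y == x)).

(** One shore of the cut attached to [x]. Its vertices at level [lev x] form the cluster of [x], and
    edges leave it only by going up from there. *)
Definition side x : pred V := fun a => connect (above (lev x)) x a.
Definition crosses x a b := side x a != side x b.
Definition free_at x a b :=
  (par x == b) && (x == a) || (par x == a) && (x == b).

Lemma above_sym l : connect_sym (above l).
Proof.
apply: sym_connect_sym => a b.
by rewrite /above /within e_sym [(_ <= _) && _]andbC.
Qed.

Lemma side_lev x a : side x a -> lev x <= lev a.
Proof.
case/connectP=> p; elim/last_ind: p => [|p b _] pp ->; first by [].
by move: pp; rewrite last_rcons rcons_path => /andP[_ /and3P[]].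
Qed.

(** An edge leaving the component must leave its range of levels, and it changes the level by at
    most 1. *)
Lemma crosses_lev x a b : e a b -> side x a -> ~~ side x b ->
  lev a = lev x /\ lev b < lev x.
Proof.
move=> eab sa sb; have la := side_lev sa.
have lb : lev b < lev x.
  rewrite ltnNge; apply: contra sb => lb; apply: connect_trans sa _.
  by apply: connect1; rewrite /above /within eab la.
split=> //; apply/eqP; rewrite eqn_leq la andbT.
exact: leq_trans (lev_lip (etrans (e_sym b a) eab)) lb.
Qed.

(** The deeper end of a crossing edge belongs to the cluster of [x], so the edge determines this
    cluster and then, by [F_uniq], the vertex [x]. *)
Lemma crosses_uniq x x' a b : e a b -> F x -> F x' ->
  crosses x a b -> crosses x' a b -> x = x'.
Proof.
move=> eab Fx Fx'; have eba : e b a by rewrite e_sym.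
have main u v : e u v -> side x u -> ~~ side x v ->
    crosses x' u v -> x = x'.
  move=> euv sx nsx; have [lu lv] := crosses_lev euv sx nsx.
  have [su|nsu] := boolP (side x' u); last first.
    rewrite /crosses (negPf nsu); case sv: (side x' v) => // _.
    have [lv' lu'] := crosses_lev (etrans (e_sym v u) euv) sv nsu.
    by move: lv; rewrite -lu lv' ltnNge ltnW.
  rewrite /crosses su; case sv: (side x' v) => // _.
  have [lu' _] := crosses_lev euv su (negbT sv).
  apply: F_uniq; rewrite -?lu' //.
  rewrite /side -?lu -?lu' in sx su; apply: connect_trans (_ : connect _ x u) _.
    by rewrite -lu.
  by rewrite above_sym -lu.
rewrite {1}/crosses; case sa: (side x a); case sb: (side x b) => // _.
  by apply: main; rewrite ?sb.
by rewrite {1}/crosses eq_sym; apply: main; rewrite ?sa.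
Qed.

Lemma free_at_crosses x a b : F x -> free_at x a b -> crosses x a b.
Proof.
move=> Fx; have [_ lx] := F_par Fx.
have sx : side x x by apply: connect0.
have sp : side x (par x) = false.
  by apply/negP => /side_lev; rewrite lx ltnn.
rewrite /free_at /crosses.
by case/orP=> /andP[/eqP<- /eqP<-]; rewrite sx sp.
Qed.

Lemma odd_crosses x a p :
  odd (esum (indic (crosses x)) a p) = (side x a != side x (last a p)).
Proof.
elim: p a => [|b p IH] a /=; first by rewrite eqxx.
rewrite oddD IH /indic /crosses oddb.
by case: (side x a); case: (side x b); case: (side x _).
Qed.

(** After the edge between [x] and [par x] is traversed, one of its ends lies behind the walk and
    cannot be visited again. *)
Lemma free_at_le1 x a p : uniq (a :: p) -> esum (indic (free_at x)) a p <= 1.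
Proof.
have out b q : x \notin b :: q -> esum (indic (free_at x)) b q = 0.
  elim: q b => //= c q IH b; rewrite !inE !negb_or => /and3P[xb xc xq].
  rewrite IH ?inE ?negb_or ?xc // addn0 /indic /free_at.
  by rewrite (negPf xb) (negPf xc) !andbF.
have outp b q : par x \notin b :: q -> esum (indic (free_at x)) b q = 0.
  elim: q b => //= c q IH b; rewrite !inE !negb_or => /and3P[xb xc xq].
  by rewrite IH ?inE ?negb_or ?xc // addn0 /indic /free_at (negPf xb) (negPf xc).
elim: p a => //= b p IH a /andP[na up].
rewrite {1}/indic; case f: (free_at x a b) => /=; last by rewrite add0n IH.
move: f; rewrite /free_at => /orP[] /andP[/eqP E1 /eqP E2].
  by rewrite out ?E2.
by rewrite outp ?E1.
Qed.

(* Each cut [side x] with x in F is crossed an even number of times by the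
   closed walk p q, at most once by a free edge of p, and an edge crosses at
   most one of these cuts. *)
Lemma free_path_size u p q : path e u p -> uniq (u :: p) ->
    path e (last u p) q -> last (last u p) q = u ->
  size p <= size q + 2 * esum (indic (fun a b => ~~ free a b)) u p.
Proof.
move=> pp up pq lq.
pose nonfree := indic (fun a b => ~~ free a b).
have sp : size p = esum (indic free) u p + esum nonfree u p.
  rewrite -esumD -(esum1 u p); elim: (p) (u) => //= b s IH a.
  by rewrite IH /nonfree /indic; case: (free a b).
(* The non-free edges are counted twice: once as edges of [p], once to bound the free ones. *)
suff : esum (indic free) u p <= esum nonfree u p + size q.
  by rewrite sp mul2n -addnn addnA leq_add2r addnC.
have cross1 a b : e a b -> \sum_(x | F x) crosses x a b <= 1.
  move=> eab; case: (pickP (fun x => F x && (crosses x a b))) => [x /andP[Fx cx]|no].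
    rewrite (bigD1 x) //= big1 ?addn0 ?leq_b1 // => y /andP[Fy yx].
    apply/eqP; rewrite eqb0; apply: contra yx => cy.
    by apply/eqP; apply: (crosses_uniq eab Fy Fx).
  rewrite big1 // => x Fx; apply/eqP; rewrite eqb0.
  by have := no x; rewrite Fx /= => ->.
pose g x a b := crosses x a b && ~~ free a b.
have le_free : esum (indic free) u p <= \sum_(x | F x) esum (indic (free_at x)) u p.
  rewrite esum_sum; apply: leq_esum pp => a b _; rewrite /indic; case fab: (free a b) => //.
  case/orP: fab => /andP[Fx Ex].
    by rewrite (bigD1 a) //= /free_at Ex eqxx.
  by rewrite (bigD1 b) //= /free_at Ex eqxx orbT.
apply: leq_trans le_free _.
have : \sum_(x | F x) (esum (indic (g x)) u p + esum (indic (crosses x)) (last u p) q)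
    <= esum nonfree u p + size q.
  rewrite big_split leq_add //= esum_sum.
    apply: leq_esum pp => a b eab; rewrite /nonfree /indic /g.
    case: (free a b); first by rewrite big1 // => x _; rewrite andbF.
    apply: leq_trans (cross1 a b eab); apply: leq_sum => x _.
    by rewrite andbT.
  by rewrite -(esum1 (last u p) q); apply: leq_esum pq => a b /cross1.
apply: leq_trans; apply: leq_sum => x Fx.
have := free_at_le1 x up; case fx: (esum (indic (free_at x)) u p) => [//|[|//]] _.
(* A free edge crossing the cut of [x] is the one between [x] and [par x]: otherwise it would also
   cross the cut of another vertex of [F], against [crosses_uniq]. *)
have gx : esum (indic (crosses x)) u p = esum (indic (free_at x)) u p + esum (indic (g x)) u p.
  rewrite -esumD; elim: (p) (u) pp => //= b s IH a /andP[eab ps].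
  rewrite (IH _ ps) /indic /g; congr (_ + _).
  case fx': (free_at x a b).
    rewrite (free_at_crosses Fx fx') /free; move: fx'; rewrite /free_at.
    by case/orP=> /andP[/eqP<- /eqP<-]; rewrite Fx eqxx ?orbT.
  case cx: (crosses x a b) => //=; case fab: (free a b) => //=.
  case/orP: fab => /andP[Fy Ey].
    have cy : crosses a a b by apply: free_at_crosses; rewrite // /free_at Ey eqxx.
    have xa := crosses_uniq eab Fx Fy cx cy.
    by move: fx'; rewrite /free_at xa Ey eqxx.
  have cy : crosses b a b.
    by apply: free_at_crosses; rewrite // /free_at Ey eqxx orbT.
  have xa := crosses_uniq eab Fx Fy cx cy.
  by move: fx'; rewrite /free_at xa Ey eqxx orbT.
(* [p] and [q] have the same ends, hence the same parity of crossings. If the free edge is the only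
   crossing of [p], then [q] crosses an odd number of times, so at least once. *)
have := odd_crosses x u p; have := odd_crosses x (last u p) q.
rewrite lq gx fx eq_sym => <-; rewrite oddD addn_gt0.
by case: (esum _ _ _) => //=; case: (esum _ _ _).
Qed.

End FreeEdges.

(** * Weakest preconditions with time *)

Ltac nlia :=
  repeat match goal with
  | H : ?T |- _ =>
    match type of T with
    | Prop =>
      lazymatch T with
      | is_true (leq _ _) => fail
      | is_true (_ && _) => fail
      | @eq nat _ _ => fail
      | ~ _ => fail
      | _ => clear H
      end
    end
  end; lia.

(** Evaluation without overflow is total and computes by reduction; the conditions under which it
    agrees with [eval] are collected apart, in [fits]. *)
Fixpoint ev (s : state) (x : expr) : nat :=
  match x with
  | Const k => k
  | Var i => var s i
  | Get a x1 => arr s a (ev s x1)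
  | Add x1 x2 => ev s x1 + ev s x2
  | Defs.Sub x1 x2 => ev s x1 - ev s x2
  | Lt x1 x2 => ev s x1 < ev s x2
  | Eq x1 x2 => ev s x1 == ev s x2
  end.

Fixpoint fits (M : nat) (s : state) (x : expr) : Prop :=
  match x with
  | Const k => k <= M
  | Var i => True
  | Get a x1 => fits M s x1
  | Add x1 x2 => [/\ fits M s x1, fits M s x2 & ev s x1 + ev s x2 <= M]
  | Defs.Sub x1 x2 | Lt x1 x2 | Eq x1 x2 => fits M s x1 /\ fits M s x2
  end.

Definition put_var s i v :=
  State (fun j => if eqn j i then v else var s j) (arr s).

(* Unlike in [set_arr], [upd] only occurs at the cells of an array, so that [cbn]
   computes the lookup of an array and leaves symbolic cells alone. *)
Definition put_arr s a i v :=
  State (var s) (fun b => if eqn b a then upd (arr s a) i v else arr s b).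

Lemma put_varE s i v : put_var s i v = set_var s i v.
Proof. by []. Qed.

Lemma put_arrE s a i v : put_arr s a i v = set_arr s a i v.
Proof. by []. Qed.

Lemma var_put_var s i v j : var (put_var s i v) j = if j == i then v else var s j.
Proof. by []. Qed.

Lemma var_put_arr s a i v : var (put_arr s a i v) = var s.
Proof. by []. Qed.

Lemma arr_put_var s i v : arr (put_var s i v) = arr s.
Proof. by []. Qed.

Lemma arr_put_arr s a i v b :
  arr (put_arr s a i v) b = if b == a then upd (arr s a) i v else arr s b.
Proof. by []. Qed.

Section Logic.
Variables (w M : nat).
Hypothesis M_lt : M < 2 ^ w.

Lemma evalE s x : fits M s x -> eval w s x = Some (ev s x).
Proof.
have fitE v : v <= M -> fit w v = Some v by rewrite /fit => /leq_ltn_trans->.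
elim: x => //= [a x IH /IH->|x IHx y IHy [/IHx-> /IHy-> le]
  |x IHx y IHy [/IHx-> /IHy->]|x IHx y IHy [/IHx-> /IHy->]
  |x IHx y IHy [/IHx-> /IHy->]] //; exact: fitE.
Qed.

Definition wp c s (Q : nat -> state -> Prop) :=
  exists t s', exec w c s t s' /\ Q t s'.

Lemma wp_mono c s (Q Q' : nat -> state -> Prop) :
  wp c s Q -> (forall t s', Q t s' -> Q' t s') -> wp c s Q'.
Proof. by move=> [t [s' [ex q]]] /(_ _ _ q) q'; exists t, s'. Qed.

Lemma wp_skip s (Q : nat -> state -> Prop) : Q 1 s -> wp Skip s Q.
Proof. by exists 1, s; split=> //; constructor. Qed.

Lemma wp_assign s i x v (Q : nat -> state -> Prop) : fits M s x ->
  ev s x = v -> Q (cost x).+1 (put_var s i v) -> wp (Assign i x) s Q.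
Proof. by rewrite put_varE => fx <- q; do 2 eexists; split; [constructor; apply: evalE|]. Qed.

Lemma wp_put s a x y i v (Q : nat -> state -> Prop) : fits M s x -> fits M s y ->
  ev s x = i -> ev s y = v ->
  Q (cost x + cost y).+1 (put_arr s a i v) -> wp (Put a x y) s Q.
Proof.
by rewrite put_arrE => fx fy <- <- q; do 2 eexists; split; [constructor; apply: evalE|].
Qed.

Lemma wp_seq c1 c2 s (Q : nat -> state -> Prop) :
  wp c1 s (fun t1 s1 => wp c2 s1 (fun t2 s2 => Q (t1 + t2) s2)) ->
  wp (Seq c1 c2) s Q.
Proof.
move=> [t1 [s1 [ex1 [t2 [s2 [ex2 q]]]]]]; exists (t1 + t2), s2.
by split=> //; econstructor; eassumption.
Qed.

Lemma wp_if x c1 c2 s (Q : nat -> state -> Prop) : fits M s x ->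
  (ev s x <> 0 -> wp c1 s (fun t s' => Q (cost x + t).+1 s')) ->
  (ev s x = 0 -> wp c2 s (fun t s' => Q (cost x + t).+1 s')) ->
  wp (If x c1 c2) s Q.
Proof.
move=> /evalE fx h1 h2.
have [t [s' [ex q]]] : wp (if ev s x != 0 then c1 else c2) s
    (fun t s' => Q (cost x + t).+1 s').
  by case: eqP => [/h2|/h1].
by exists (cost x + t).+1, s'; split=> //; econstructor; eassumption.
Qed.

(** The invariant also speaks of the time spent since the loop was entered, tests included, so that
    amortised bounds can be stated in it; [m] is the variant. *)
Lemma wp_while x c s (J : nat -> state -> Prop) (m : state -> nat)
    (Q : nat -> state -> Prop) :
  J 0 s ->
  (forall t s, J t s -> fits M s x) ->
  (forall t s, J t s -> ev s x = 0 -> Q (t + cost x).+1 s) ->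
  (forall t s, J t s -> ev s x <> 0 ->
     wp c s (fun t' s' => J (t + cost x + t').+1 s' /\ m s' < m s)) ->
  wp (While x c) s Q.
Proof.
move=> Js fx done step.
suff main k : forall t s, m s < k -> J t s ->
    exists t' s', exec w (While x c) s t' s' /\ Q (t + t') s'.
  by apply: main Js; apply: ltnSn.
elim: k => // k IH t {Js}s lt_m Js; have ex := evalE (fx _ _ Js).
have [ex0|/eqP ex0] := eqVneq (ev s x) 0.
  exists (cost x).+1, s; rewrite ex0 in ex; split; first by constructor.
  by rewrite addnS; apply: done.
have [t1 [s1 [e1 [J1 m1]]]] := step _ _ Js ex0.
have [|t2 [s2 [e2 Q2]]] := IH _ s1 _ J1; first exact: leq_trans m1 lt_m.
exists (cost x + t1 + t2).+1, s2; split.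
  by apply: ExecWhileStep ex _ e1 e2; apply/eqP.
by rewrite addnS !addnA; rewrite addSn in Q2.
Qed.

End Logic.

Lemma upd_same (A : Type) (f : nat -> A) i a : upd f i a i = a.
Proof. by rewrite /upd eqxx. Qed.

Lemma upd_other (A : Type) (f : nat -> A) i a j : j != i -> upd f i a j = f j.
Proof. by rewrite /upd => /negPf->. Qed.

Definition stE := (var_put_var, var_put_arr, arr_put_var, arr_put_arr).

Ltac st := cbn [var arr put_var put_arr eqn ev fits cost].

Ltac fit_tac := st; repeat match goal with
  | |- _ /\ _ => split
  | |- and3 _ _ _ => split
  end; first [done | nlia].

Ltac wp_straight M_lt := repeat first
  [ apply: wp_seq
  | (apply: (wp_put M_lt); [by fit_tac|by fit_tac|by st; reflexivity|by st; reflexivity|])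
  | (apply: (wp_assign M_lt); [by fit_tac|by st; reflexivity|])
  | apply: wp_skip ].

(** * The breadth-first search invariant *)

Record nat_graph n (en : rel nat) (off A : nat -> nat) := NatGraph {
  en_lt : forall x y, en x y -> x < n /\ y < n;
  en_sym : symmetric en;
  en_irr : irreflexive en;
  en_conn : forall y, y < n -> exists2 p, path en 0 p & last 0 p = y;
  off_mono : forall x, x < n -> off x <= off x.+1;
  off0 : off 0 = 0;
  adj_en : forall x k, x < n -> off x <= k < off x.+1 -> en x (A k);
  en_adj : forall x y, en x y -> exists2 k, off x <= k < off x.+1 & A k = y }.

Lemma sum_uniq_le (n : nat) (f : nat -> nat) (s : seq nat) :
  uniq s -> {in s, forall x, x < n} -> \sum_(x <- s) f x <= \sum_(0 <= x < n) f x.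
Proof.
move=> us lt_s; rewrite /index_iota subn0.
have sub : {subset s <= iota 0 n} by move=> x /lt_s; rewrite mem_iota.
rewrite [leqRHS](bigID (mem s)) /= -[leqLHS]addn0 leq_add //.
rewrite -[leqRHS]big_filter (@perm_big _ _ _ _ s [seq x <- iota 0 n | x \in s]) //.
apply: uniq_perm; rewrite ?filter_uniq ?iota_uniq // => x.
by rewrite mem_filter; case: (boolP (x \in s)) => //= /sub ->.
Qed.

Section Bfs.
Variables (n : nat) (en zr : rel nat) (off A : nat -> nat).
Hypothesis gr : nat_graph n en off A.

(* After the first i vertices of the queue Q have been scanned for all edges
   and the first j for the edges of length 0. *)
Record bfs_inv q i j (Q D V P O2 O3 : nat -> nat) : Prop := BfsInv {
  b_q : 0 < q;
  b_ij : i <= j;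
  b_jq : j <= q;
  b_Qlt : forall k, k < q -> Q k < n;
  b_Qinj : forall k k', k < q -> k' < q -> Q k = Q k' -> k = k';
  b_V : forall x, x < n -> V x <> 0 <-> exists2 k, k < q & Q k = x;
  b_Q0 : Q 0 = 0;
  b_D0 : D 0 = 0;
  b_P : forall k, 0 < k < q -> exists k', [/\ k' < k, P (Q k) = Q k',
    en (Q k') (Q k) & D (Q k) = D (Q k') + ~~ zr (Q k') (Q k)];
  b_O : forall k, 0 < k < q -> O2 k.-1 = Q k /\ O3 k.-1 = P (Q k);
  b_sorted : forall k k', k <= k' -> k' < q -> D (Q k) <= D (Q k');
  b_i : forall k y, k < i -> en (Q k) y -> V y <> 0 /\ D y <= (D (Q k)).+1;
  b_j : forall k y, k < j -> en (Q k) y -> zr (Q k) y ->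
    V y <> 0 /\ D y <= D (Q k);
  b_spread : i < q -> forall k, k < q -> D (Q k) <= (D (Q i)).+1;
  b_tail : forall k, j <= k < q -> D (Q k) = D (Q j) }.

(** The conditions on [d] are what allows [y] at the end of the queue: [d] is a largest distance,
    exceeds that at pointer [i] by at most 1, and equals that of all entries still waiting for their
    scan for length 0. *)
Lemma bfs_inv_push q i j Q D V P O2 O3 kz y z d :
    bfs_inv q i j Q D V P O2 O3 -> kz < q -> z = Q kz -> en z y -> V y = 0 ->
    i < q -> d = D z + ~~ zr z y -> (forall k, k < q -> D (Q k) <= d) ->
    d <= (D (Q i)).+1 -> (forall k, j <= k < q -> D (Q k) = d) ->
  bfs_inv q.+1 i j (upd Q q y) (upd D y d) (upd V y 1) (upd P y z)
    (upd O2 q.-1 y) (upd O3 q.-1 z).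
Proof.
move=> b ltkz zE ezy Vy iq dE le_d d_le tail.
have [zn yn] := en_lt gr ezy.
have q0 := b_q b.
have QC k : k < q -> upd Q q y k = Q k.
  by move=> kq; rewrite upd_other // neq_ltn kq.
have Qy k : k < q -> Q k != y.
  move=> kq; apply/eqP=> E; have [_ /(_ _)] := b_V b yn.
  by rewrite Vy; apply=> //; exists k.
have DC k : k < q -> upd D y d (Q k) = D (Q k) by move=> /Qy ?; rewrite upd_other.
have PC k : k < q -> upd P y z (Q k) = P (Q k) by move=> /Qy ?; rewrite upd_other.
have Qq : upd Q q y q = y by rewrite upd_same.
have split_q k : k < q.+1 -> k < q \/ k = q.
  by rewrite ltnS leq_eqVlt => /orP[/eqP|]; [right|left].
have VC x : V x <> 0 -> upd V y 1 x <> 0 /\ upd D y d x = D x.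
  move=> Vx; have xy : x != y by apply/eqP => E; rewrite E Vy in Vx.
  by rewrite !upd_other.
split.
- by [].
- exact: b_ij b.
- exact: leqW (b_jq b).
- by move=> k /split_q[kq|->]; rewrite ?Qq ?QC //; apply: (b_Qlt b).
- move=> k k' /split_q[kq|->] /split_q[kq'|->] //; rewrite ?Qq ?QC //.
  + exact: (b_Qinj b).
  + by move=> E; have := Qy _ kq; rewrite E eqxx.
  + by move=> E; have := Qy _ kq'; rewrite E eqxx.
- move=> x xn; have [->|xy] := eqVneq x y.
    by rewrite upd_same; split=> // _; exists q.
  rewrite upd_other //; split.
    move=> /(b_V b xn)[k kq <-]; exists k; rewrite ?QC //; exact: leqW.
  move=> [k /split_q[kq|->]]; last by rewrite Qq => E; rewrite E eqxx in xy.
  by rewrite QC // => E; apply/(b_V b xn); exists k.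
- by rewrite QC // (b_Q0 b).
- by rewrite -{1}(b_Q0 b) DC // (b_Q0 b) (b_D0 b).
- move=> k /andP[k0 /split_q[kq|->]].
    have [|k' [lt PQ eQ DQ]] := b_P b (k := k); first by rewrite k0.
    have kq' := ltn_trans lt kq.
    by exists k'; rewrite !QC // PC // !DC.
  by exists kz; rewrite Qq QC // !upd_same DC // -zE -dE.
- move=> k /andP[k0 /split_q[kq|->]]; last by rewrite Qq !upd_same.
  have kq1 : k.-1 != q.-1.
    by apply/eqP=> E; rewrite -(prednK k0) -(prednK q0) E ltnn in kq.
  by rewrite QC // PC // !upd_other //; apply: (b_O b); rewrite k0.
- move=> k k' kk' /split_q[kq'|Ek'].
    have kq := leq_ltn_trans kk' kq'.
    by rewrite !QC ?DC //; apply: (b_sorted b).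
  rewrite Ek' Qq upd_same; move: kk'; rewrite Ek' leq_eqVlt => /orP[/eqP->|kq].
    by rewrite Qq upd_same.
  by rewrite QC // DC // le_d.
- move=> k x ki; have kq : k < q by apply: ltn_trans iq.
  by rewrite QC // DC // => /(b_i b ki)[/VC[? ->]].
- move=> k x kj; have kq : k < q by apply: leq_trans (b_jq b).
  by rewrite QC // DC // => /(b_j b kj) h /h[/VC[? ->]].
- move=> _ k; rewrite (QC i) // (DC i) // => /split_q[kq|->].
    by rewrite QC // DC // (b_spread b).
  by rewrite Qq upd_same.
- move=> k; move: (b_jq b); rewrite leq_eqVlt => /orP[/eqP<-|jq] /andP[jk].
    by rewrite ltnS => kj; have -> : k = j by apply/eqP; rewrite eqn_leq kj jk.
  rewrite (QC j) // (DC j) // => /split_q[kq|->].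
    by rewrite QC // DC // (b_tail b) // jk.
  by rewrite Qq upd_same tail // leqnn.
Qed.

Lemma bfs_inv_next_i q i j Q D V P O2 O3 :
    bfs_inv q i j Q D V P O2 O3 -> i < j ->
    (forall y, en (Q i) y -> V y <> 0 /\ D y <= (D (Q i)).+1) ->
  bfs_inv q i.+1 j Q D V P O2 O3.
Proof.
move=> b ij scan; have iq := leq_trans ij (b_jq b).
case: b => q0 _ jq Qlt Qinj Vq Q0 D0 Pq Oq sorted si sj spread tail.
split=> //.
  by move=> k y; rewrite ltnS leq_eqVlt => /predU1P[->|]; [apply: scan|apply: si].
move=> iq' k kq; apply: leq_trans (spread iq k kq) _.
by rewrite ltnS sorted.
Qed.

Lemma bfs_inv_next_j q i j Q D V P O2 O3 :
    bfs_inv q i j Q D V P O2 O3 -> j < q ->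
    (forall y, en (Q j) y -> zr (Q j) y -> V y <> 0 /\ D y <= D (Q j)) ->
  bfs_inv q i j.+1 Q D V P O2 O3.
Proof.
case=> q0 ij _ Qlt Qinj Vq Q0 D0 Pq Oq sorted si sj spread tail jq scan.
split=> //; first exact: leqW.
  by move=> k y; rewrite ltnS leq_eqVlt => /predU1P[->|]; [apply: scan|apply: sj].
move=> k /andP[jk kq]; rewrite (tail k) ?(ltnW jk) // (tail j.+1) // leqnSn.
exact: leq_ltn_trans kq.
Qed.

(** Parents precede children in the queue and an edge adds at most 1. This keeps the stored
    distances within a word. *)
Lemma bfs_inv_D q i j Q D V P O2 O3 k :
  bfs_inv q i j Q D V P O2 O3 -> k < q -> D (Q k) <= k.
Proof.
move=> b; have [m] := ubnP k; elim: m k => // m IH k km kq.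
case: k km kq => [|k] km kq; first by rewrite (b_Q0 b) (b_D0 b).
have [|k' [lt _ _ ->]] := b_P b (k := k.+1); first by [].
have := IH k' (leq_trans lt km) (ltn_trans lt kq) => le_D.
by rewrite (leq_trans (leq_add le_D (leq_b1 _))) ?addn1.
Qed.

Lemma bfs_inv_uniq q i j Q D V P O2 O3 : bfs_inv q i j Q D V P O2 O3 ->
  uniq (map Q (iota 0 q)) /\ {in map Q (iota 0 q), forall x, x < n}.
Proof.
move=> b; split.
  rewrite map_inj_in_uniq ?iota_uniq // => k k'.
  by rewrite !mem_iota !add0n; apply: (b_Qinj b).
by move=> x /mapP[k]; rewrite mem_iota add0n => kq ->; apply: (b_Qlt b).
Qed.

Lemma bfs_inv_qn q i j Q D V P O2 O3 : bfs_inv q i j Q D V P O2 O3 -> q <= n.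
Proof.
case/bfs_inv_uniq=> /uniq_leq_size us lt_s.
rewrite -(size_iota 0 q) -(size_map Q) -[n](size_iota 0).
by apply: us => x /lt_s; rewrite mem_iota.
Qed.

Definition deg x := off x.+1 - off x.

Lemma off_sum x : x <= n -> off x = \sum_(0 <= k < x) deg k.
Proof.
elim: x => [|x IH] lt; first by rewrite big_nil (off0 gr).
by rewrite big_nat_recr //= -IH ?subnKC ?(off_mono gr) // ltnW.
Qed.

Lemma off_le x y : x <= y -> y <= n -> off x <= off y.
Proof.
move=> xy yn; rewrite !off_sum ?(leq_trans xy) //.
by rewrite (@big_cat_nat _ _ _ x 0 y) //= leq_addr.
Qed.

Lemma bfs_deg_sum q i j Q D V P O2 O3 m m' :
  bfs_inv q i j Q D V P O2 O3 -> m <= m' -> m' <= q ->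
  \sum_(m <= k < m') deg (Q k) <= off n.
Proof.
move=> /bfs_inv_uniq[us lt_s] mm' mq.
rewrite off_sum //; apply: leq_trans (sum_uniq_le _ us lt_s).
rewrite big_map; have -> : iota 0 q = index_iota 0 q by rewrite /index_iota subn0.
rewrite (@big_cat_nat _ _ _ m 0 q) //= ?(leq_trans mm') //.
by rewrite (@big_cat_nat _ _ _ m' m q) //= addnCA leq_addr.
Qed.

Lemma bfs_inv_done q Q D V P O2 O3 : bfs_inv q q q Q D V P O2 O3 ->
  q = n /\ forall x, x < n -> exists2 k, k < n & Q k = x.
Proof.
move=> b; have all x : x < n -> exists2 k, k < q & Q k = x.
  move=> xn; have [p] := en_conn gr xn; elim/last_ind: p x {xn} => [|p y IH] x.
    by move=> _ <-; exists 0; rewrite ?(b_q b) // (b_Q0 b).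
  rewrite rcons_path last_rcons => /andP[pp eyx] <-.
  have [k kq Qk] := IH _ pp erefl; rewrite -Qk in eyx.
  have [_ yn] := en_lt gr eyx.
  by have [/(b_V b yn)] := b_i b kq eyx.
have qn : q = n.
  apply/eqP; rewrite eqn_leq (bfs_inv_qn b) /=.
  have : {subset iota 0 n <= map Q (iota 0 q)}.
    move=> x; rewrite mem_iota add0n => /all[k kq <-].
    by apply: map_f; rewrite mem_iota.
  by move/(uniq_leq_size (iota_uniq 0 n)); rewrite size_map !size_iota.
by split=> // x /all; rewrite qn.
Qed.

(** The form in which the optimality of the distances is used: summed along a walk ending at 0, it
    bounds the distance of its start by the length of the walk. *)
Lemma bfs_inv_lip q Q D V P O2 O3 : bfs_inv q q q Q D V P O2 O3 ->
  forall x y, en x y -> D y <= D x + ~~ zr x y.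
Proof.
move=> b x y exy; have [xn _] := en_lt gr exy.
have [qn /(_ x xn)[k kn Qk]] := bfs_inv_done b; rewrite -qn in kn.
rewrite -Qk in exy *; case: (boolP (zr _ _)) => [zxy|_].
  by have [_] := b_j b kn exy zxy; rewrite addn0.
by have [_] := b_i b kn exy; rewrite addn1.
Qed.

End Bfs.

(** * Execution of the breadth-first search *)

Definition blk (cs : seq cmd) : cmd := foldr Seq Skip cs.

(* Arrays 4, 5, 6 and 7 hold the queue, the distances from vertex 0, the flags of
   the visited vertices and their parents; arrays 2 and 3 receive the output.
   The cell of array 8 at the lower end x of an edge of length 0 contains the
   successor of the other end; its other cells contain 0. *)
Definition bfs_push : cmd := blk
  [:: Put 4 (Var 1) (Var 7);
      Put 5 (Var 7) (Add (Get 5 (Var 4)) (Var 5));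
      Put 6 (Var 7) (Const 1);
      Put 7 (Var 7) (Var 4);
      Put 2 (Defs.Sub (Var 1) (Const 1)) (Var 7);
      Put 3 (Defs.Sub (Var 1) (Const 1)) (Var 4);
      Assign 1 (Add (Var 1) (Const 1))].

(** Variable 5 is both the mode of the scan and the length added by a push: in mode 1 the edges of
    length 0 at this vertex have been scanned before, so an unvisited neighbour is at the end of an
    edge of length 1. Both ends are tested because array 8 records an edge at one end only. *)
Definition bfs_scan : cmd := blk
  [:: Assign 7 (Get 1 (Var 6));
      Assign 6 (Add (Var 6) (Const 1));
      If (Get 6 (Var 7)) Skip
        (If (Add (Var 5)
               (Add (Eq (Get 8 (Var 7)) (Add (Var 4) (Const 1)))
                    (Eq (Get 8 (Var 4)) (Add (Var 7) (Const 1)))))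
           bfs_push Skip)].

(* Variable 1 is the length of the queue. Variable 3 points to the next vertex to
   scan for edges of length 0, variable 2 to the next one to scan for all edges,
   which happens only when no scan for edges of length 0 is pending. *)
Definition bfs_step : cmd := blk
  [:: Assign 5 (Eq (Var 3) (Var 1));
      If (Var 5) (Assign 4 (Get 4 (Var 2))) (Assign 4 (Get 4 (Var 3)));
      Assign 6 (Get 0 (Var 4));
      While (Lt (Var 6) (Get 0 (Add (Var 4) (Const 1)))) bfs_scan;
      Assign 2 (Add (Var 2) (Var 5));
      Assign 3 (Add (Var 3) (Defs.Sub (Const 1) (Var 5)))].

(** While array 8 is 0 this is the plain search that computes the levels; run again on the free
    edges, it builds the spanner. *)
Definition bfs : cmd := blk
  [:: Put 4 (Const 0) (Const 0); Put 5 (Const 0) (Const 0);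
      Put 6 (Const 0) (Const 1);
      Assign 1 (Const 1); Assign 2 (Const 0); Assign 3 (Const 0);
      While (Lt (Var 2) (Var 1)) bfs_step].

Section BfsRun.
Variables (w M n : nat) (en : rel nat) (off A fp : nat -> nat).
Hypotheses (M_lt : M < 2 ^ w) (n_gt0 : 0 < n) (gr : nat_graph n en off A).
Hypotheses (n_lt : n + 3 <= M) (off_lt : off n < M).

Definition zero_edge : rel nat := fun x y => (fp y == x.+1) || (fp x == y.+1).

Definition input_kept (s : state) :=
  [/\ var s 0 = n, arr s 0 = off, arr s 1 = A & arr s 8 = fp].

Lemma input_kept_var s i v : i != 0 -> input_kept s -> input_kept (put_var s i v).
Proof. by move=> i0 [? ? ? ?]; split; rewrite ?stE // eq_sym (negPf i0). Qed.

Lemma input_kept_arr s a i v :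
  a \notin [:: 0; 1; 8] -> input_kept s -> input_kept (put_arr s a i v).
Proof.
rewrite !inE !negb_or => /and3P[a0 a1 a8] [? ? ? ?].
by split; rewrite ?stE // eq_sym ?(negPf a0) ?(negPf a1) ?(negPf a8).
Qed.

Ltac kept := repeat first [by []
  | apply: input_kept_var; [by []|] | apply: input_kept_arr; [by []|]].

Definition bfs_st s := bfs_inv n en zero_edge (var s 1) (var s 2) (var s 3)
  (arr s 4) (arr s 5) (arr s 6) (arr s 7) (arr s 2) (arr s 3).

(* z is the vertex under scan and d its distance; i0 and j0 are the values of
   the scan pointers, mode that of variable 5. *)
Definition scan_inv (i0 j0 z mode d t : nat) s :=
  [/\ input_kept s, bfs_st s,
      [/\ var s 2 = i0, var s 3 = j0, var s 4 = z & var s 5 = mode],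
      [/\ off z <= var s 6 <= off z.+1, arr s 5 z = d & t <= 100 * (var s 6 - off z)] &
      [/\ forall k, off z <= k < var s 6 ->
           (mode = 1 \/ zero_edge z (A k)) ->
           arr s 6 (A k) <> 0 /\ arr s 5 (A k) <= d + mode,
          exists2 kz, kz < var s 1 & arr s 4 kz = z,
          mode = 1 -> i0 < j0 /\ arr s 4 i0 = z
             /\ forall k, j0 <= k < var s 1 -> arr s 5 (arr s 4 k) = d.+1,
          mode <> 1 -> [/\ mode = 0, j0 < var s 1 & arr s 4 j0 = z]
        & i0 < var s 1]].

(** The 6 is the cost of the test of the scanning loop, as [wp_while] charges it. *)
Lemma scan_step i0 j0 z mode d t s : z < n -> mode <= 1 ->
    scan_inv i0 j0 z mode d t s -> var s 6 < off z.+1 ->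
  wp w bfs_scan s (fun t' s' => [/\ scan_inv i0 j0 z mode d (t + 6 + t').+1 s',
    var s' 6 = (var s 6).+1, var s 1 <= var s' 1
    & forall k, k < var s 1 -> arr s' 4 k = arr s 4 k]).
Proof.
move=> zn mode1 [ik b [i2 j3 z4 m5] [k6 dz ht]
  [sc [kz kzq Qkz] md1 md0 iq]] kz6.
have [n0 o0 A0 f0] := ik; have off_n : off z.+1 <= off n := off_le gr zn (leqnn n).
rewrite /bfs_st in b; set k := var s 6 in k6 ht sc kz6 *.
have kA : off z <= k < off z.+1 by case/andP: k6 => -> _.
have ezy := adj_en gr zn kA.
have [_ yn] := en_lt gr ezy.
have Dzn : d <= n.
  have := bfs_inv_D b kzq; have := bfs_inv_qn b; rewrite Qkz dz; nlia.
have i2q : var s 2 < var s 1 by rewrite i2.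
(* A vertex visited earlier already satisfies the bound: in mode 1 by [b_spread]; in mode 0 by
   [b_sorted] up to pointer [j0] and by [b_tail] after it. *)
have bounds x : x < n -> arr s 6 x <> 0 -> (mode = 1 \/ mode <> 1) -> arr s 5 x <= d + mode.
  move=> xn /(b_V b xn)[k' kq' <-] [mE|mE].
    have [_ [Qi _]] := md1 mE; rewrite mE addn1 -dz -Qi -i2.
    exact: b_spread b i2q _ kq'.
  have [-> jq Qj] := md0 mE; rewrite addn0 -dz -Qj.
  have [le|lt] := leqP k' j0; first exact: (b_sorted b).
  have := b_tail b (k := k'); rewrite j3 => -> //; by rewrite (ltnW lt).
have dich : mode = 1 \/ mode <> 1 by case: (mode =P 1); [left|right].
have scan_next (V' D' : nat -> nat) :
    (V' (A k) <> 0 /\ D' (A k) <= d + mode) \/ (mode <> 1 /\ ~~ zero_edge z (A k)) ->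
    (forall x, x < n -> arr s 6 x <> 0 -> V' x <> 0 /\ D' x = arr s 5 x) ->
    forall k', off z <= k' < k + 1 -> mode = 1 \/ zero_edge z (A k') ->
    V' (A k') <> 0 /\ D' (A k') <= d + mode.
  move=> new old k' /andP[ok']; rewrite addn1 ltnS leq_eqVlt.
  case/predU1P=> [->|lt] h.
    by case: new => // -[m1 nz]; case: h => // zz; rewrite zz in nz.
  have ek' : off z <= k' < k by rewrite ok'.
  have [V1 D1] := sc k' ek' h.
  have xn : A k' < n.
    have kA' : off z <= k' < off z.+1 by rewrite ok' (ltn_trans lt kz6).
    by have [] := en_lt gr (adj_en gr zn kA').
  by have [V2 ->] := old _ xn V1.
have kM : var s 6 + 1 <= M by rewrite -/k; nlia.
wp_straight M_lt; apply: (wp_if M_lt); first by [].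
  st; rewrite A0 -/k => Vy; wp_straight M_lt; split=> [|||k' _]; try by st; rewrite -/k ?addn1.
  split; rewrite /bfs_st; st; first by kept.
  - by [].
  - by [].
  - by rewrite -/k addn1; split => //; nlia.
  split=> //; last by exists kz.
  by apply: scan_next => //; left; split=> //; apply: bounds.
st => Vy; rewrite A0 -/k in Vy; apply: (wp_if M_lt).
  st; rewrite z4 m5; split=> //; last first.
    apply: (@leq_trans 3); last by nlia.
    by rewrite (@leq_add _ _ 1 2) // (@leq_add _ _ 1 1) ?leq_b1.
  split=> //; last by apply: (@leq_trans 2); [rewrite (@leq_add _ _ 1 1) ?leq_b1|nlia].
    by split=> //; split=> //; nlia.
  split=> //; split=> //; last by rewrite A0 -/k; nlia.
  by nlia.
  st; rewrite /bfs_push => cond.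
  have Dm : arr s 5 (var s 4) + var s 5 <= M by rewrite z4 m5 dz; nlia.
  have qM : var s 1 + 1 <= M by have := bfs_inv_qn b; nlia.
  wp_straight M_lt.
  split=> [|||k' kq']; try by st; rewrite -/k ?addn1 ?upd_other ?neq_ltn ?kq'.
  (* In mode 1 an edge of length 0 is excluded: pointer [j0] has passed [z], so the other end would
     be visited, against [Vy]. *)
  have {cond} dE : d + mode = arr s 5 z + ~~ zero_edge z (A k).
    rewrite dz; congr (_ + _); have [mE|mE] := dich.
      have [ij [Qi _]] := md1 mE; rewrite mE; case zzy: (zero_edge z (A k)) => //.
      rewrite -j3 in ij; have := b_j b (k := i0) (y := A k) ij.
      by rewrite Qi => /(_ ezy zzy)[].
    have [m0 _ _] := md0 mE; rewrite m0 in cond *.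
    suff -> : zero_edge z (A k) by [].
    rewrite /zero_edge; move: cond; rewrite A0 -/k f0 z4 m5 m0 !addn1.
    by case: (fp (A k) == _); case: (fp z == _).
  have le_d k' : k' < var s 1 -> arr s 5 (arr s 4 k') <= d + mode.
    by move=> kq'; apply: bounds => //; [apply: (b_Qlt b)|apply/(b_V b); rewrite ?(b_Qlt b) //; exists k'].
  have d_le : d + mode <= (arr s 5 (arr s 4 (var s 2))).+1.
    have [mE|mE] := dich; first by have [_ [Qi _]] := md1 mE; rewrite i2 Qi dz mE addn1.
    have [m0 jq Qj] := md0 mE; rewrite m0 addn0 -dz -Qj.
    exact: b_spread b i2q _ jq.
  have tail k' : var s 3 <= k' < var s 1 -> arr s 5 (arr s 4 k') = d + mode.
    rewrite j3; have [mE|mE] := dich; first by have [_ [_ tl]] := md1 mE; rewrite mE addn1 => /tl.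
    by have [m0 jq Qj] := md0 mE; rewrite m0 addn0 -dz -Qj -j3; apply: b_tail b _.
  have b' := bfs_inv_push gr b kzq (esym Qkz) ezy Vy i2q dE le_d d_le tail.
  have yz : z != A k by apply/eqP=> E; rewrite -E (en_irr gr) in ezy.
  split; first by kept.
  - by rewrite /bfs_st; st; rewrite A0 -/k z4 m5 dz addn1 subn1.
  - by st.
  - by st; rewrite A0 -/k upd_other // dz; split=> //; nlia.
  st; rewrite A0 -/k z4 m5 dz; split.
  - apply: scan_next; first by left; rewrite !upd_same.
    move=> x xn Vx; have xy : x != A k by apply/eqP=> E; rewrite E Vy in Vx.
    by rewrite !upd_other.
  - exists kz; first by rewrite addn1 leqW.
    by rewrite upd_other // neq_ltn kzq.
  - move=> mE; have [ij [Qi tl]] := md1 mE; rewrite upd_other ?neq_ltn ?iq //.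
    split=> //; split=> // k'; rewrite addn1 ltnS andbC leq_eqVlt => /andP[/predU1P[->|kq'] jk].
      by rewrite !upd_same mE addn1.
    have kq1 : k' != var s 1 by rewrite neq_ltn kq'.
    rewrite (upd_other _ _ kq1) upd_other ?tl ?jk //.
    by apply/eqP=> E; have := b_V b yn; rewrite Vy => -[_]; apply=> //; exists k'.
  - move=> mE; have [m0 jq Qj] := md0 mE; split=> //; first by rewrite addn1 leqW.
    by rewrite upd_other // neq_ltn jq.
  - by rewrite addn1 leqW.
st; rewrite m5 A0 -/k f0 z4 => /eqP; rewrite !addn_eq0 => /and3P[/eqP m0 nz1 nz2].
have nzr : ~~ zero_edge z (A k).
  by move: nz1 nz2; rewrite !eqb0 !addn1 /zero_edge negb_or => -> ->.
wp_straight M_lt.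
split=> [|||k' _]; try by st; rewrite -/k ?addn1.
split; rewrite /bfs_st; st; first by kept.
- by [].
- by [].
- by rewrite -/k; split => //; nlia.
rewrite -/k; split=> //; last by exists kz.
by apply: scan_next => //; right; split=> //; rewrite m0.
Qed.

(** The position [m] is the one scanned, to which the cost is charged; each position is charged once
    per pointer. *)
Lemma bfs_step_wp s : input_kept s -> bfs_st s -> var s 2 < var s 1 ->
  wp w bfs_step s (fun t' s' => exists2 m, m < var s 1 &
   [/\ input_kept s', bfs_st s', forall k, k < var s 1 -> arr s' 4 k = arr s 4 k,
      t' <= 100 * (deg off (arr s 4 m)).+1 &
      (m = var s 2 /\ var s' 2 = (var s 2).+1 /\ var s' 3 = var s 3) \/
      (m = var s 3 /\ var s' 2 = var s 2 /\ var s' 3 = (var s 3).+1)]).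
Proof.
move=> ik b iq; have [n0 o0 A0 f0] := ik; rewrite /bfs_st in b.
have qn := bfs_inv_qn b; have jq := b_jq b; have ij := b_ij b.
pose mode : nat := var s 3 == var s 1.
have modeE : (mode = 1 /\ var s 3 = var s 1) \/ (mode = 0 /\ var s 3 < var s 1).
  rewrite /mode ltn_neqAle jq andbT.
  by case: eqP => [->|]; [left|right].
pose m := if mode == 1 then var s 2 else var s 3.
have mq : m < var s 1 by rewrite /m; case: (modeE) => -[-> ?].
set z := arr s 4 m; have zn : z < n := b_Qlt b mq.
have off_z := off_mono gr zn; have off_zn := off_le gr zn (leqnn n).
have Dz : arr s 5 z <= n by have := bfs_inv_D b mq; rewrite -/z; nlia.
have mode_le1 : mode <= 1 by apply: leq_b1.
apply: wp_seq; apply: (wp_assign M_lt (v := mode)); [by []|by []|].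
have wp_z : wp w (If (Var 5) (Assign 4 (Get 4 (Var 2))) (Assign 4 (Get 4 (Var 3))))
    (put_var s 5 mode) (fun t s' => t <= 10 /\ s' = put_var (put_var s 5 mode) 4 z).
  apply: (wp_if M_lt) => //; st => h; wp_straight M_lt; split=> //; congr put_var.
    by rewrite /z /m; case: (modeE) h => -[->].
  by rewrite /z /m; case: (modeE) h => -[->].
apply: wp_seq; apply: wp_mono wp_z _ => t1 _ [t1_le ->].
apply: wp_seq; apply: (wp_assign M_lt); [by []|by st; reflexivity|].
st; rewrite o0; set s1 := put_var _ 6 _.
have s1_inv : scan_inv (var s 2) (var s 3) z mode (arr s 5 z) 0 s1.
  split; first by kept.
  - exact: b.
  - by [].
  - by rewrite /s1; st; rewrite leqnn off_z.
  rewrite /s1; st; split=> //.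
  - by move=> k; rewrite leqNgt andbC => /andP[->].
  - by exists m.
  - case: (modeE); last by move=> [-> _].
    move=> [-> E]; split; first by rewrite E.
    split; first by rewrite /z /m; case: (modeE) => -[->] //; rewrite E ltnn.
    by move=> k; rewrite E leqNgt andbC => /andP[->].
  - by case: (modeE) => -[mE E]; [rewrite mE|split=> //; rewrite /z /m mE].
pose J t s' := [/\ scan_inv (var s 2) (var s 3) z mode (arr s 5 z) t s',
  var s 1 <= var s' 1 & forall k, k < var s 1 -> arr s' 4 k = arr s 4 k].
apply: wp_seq; apply: (wp_while M_lt (J := J) (m := fun s' => off z.+1 - var s' 6)).
- by split.
- move=> t s' [[ik' _ [_ _ z4 _] _ _] _ _]; rewrite /=; split=> //; split=> //; first by nlia.
  by rewrite z4; nlia.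
- move=> t s' [[ik' b' [i2 j3 z4 m5] [k6 dz ht] [sc _ md1 md0 iq']] qq Qs] /=.
  have [n0' o0' A0' f0'] := ik'.
  rewrite z4 o0' addn1 => /eqP; rewrite eqb0 -leqNgt => k_ge.
  wp_straight M_lt; exists m => //; rewrite -/z.
  split; first by kept.
  + rewrite /bfs_st; st; rewrite i2 j3 m5.
    rewrite /bfs_st i2 j3 in b'.
    have scanned y : en z y -> mode = 1 \/ zero_edge z y ->
        arr s' 6 y <> 0 /\ arr s' 5 y <= arr s' 5 z + mode.
      move=> /(en_adj gr)[k /andP[k1 k2] <-]; rewrite dz; apply: sc.
      by rewrite k1 (leq_trans k2).
    case: (modeE) => -[mE E].
      have [lt_ij [Qi _]] := md1 mE; rewrite mE addn1 subnn addn0.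
      apply: bfs_inv_next_i b' lt_ij _ => y; rewrite Qi => /scanned.
      by rewrite mE addn1; apply; left.
    have [_ lt_jq Qj] : [/\ mode = 0, var s 3 < var s' 1 & arr s' 4 (var s 3) = z].
      by apply: md0; rewrite mE.
    rewrite mE addn0 subn0 addn1; apply: bfs_inv_next_j b' lt_jq _ => y.
    by rewrite Qj => /scanned h zzy; have := h (or_intror zzy); rewrite mE addn0.
  + by st.
  + by st; rewrite /deg; case/andP: k6 => *; nlia.
  + st; rewrite i2 j3 m5 /m; case: (modeE) => -[mE E]; rewrite mE /=.
      by left; rewrite addn0 addn1.
    by right; rewrite addn0 addn1.
- move=> t s' [inv qq Qs]; have [_ _ [_ _ z4 _] _ _] := inv.
  have [[_ o0' _ _] _ _ _ _] := inv.
  rewrite /= z4 o0' addn1 => /eqP; rewrite eqb0 negbK => lt_k.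
  have := scan_step zn mode_le1 inv lt_k.
  move/wp_mono; apply => t' s'' [inv' k'' qq' Qs']; split; last by rewrite k''; nlia.
  split; [exact: inv'|exact: leq_trans qq qq'|].
  by move=> k kq; rewrite Qs' ?Qs // (leq_trans kq).
Qed.

Lemma bfs_wp s : input_kept s -> (forall x, x < n -> arr s 6 x = 0) ->
  wp w bfs s (fun t' s' => [/\ input_kept s',
    bfs_inv n en zero_edge n n n (arr s' 4) (arr s' 5) (arr s' 6) (arr s' 7) (arr s' 2)
      (arr s' 3) & t' <= 220 * (n + off n) + 40]).
Proof.
move=> ik V0; rewrite /bfs; wp_straight M_lt.
pose S (Q : nat -> nat) m := \sum_(0 <= k < m) deg off (Q k).
(* Each of the two pointers pays for the degrees it has passed, and either sum is at most
   [off n]. *)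
pose J t s' := [/\ input_kept s', bfs_st s' &
  t <= 105 * (var s' 2 + var s' 3) + 100 * (S (arr s' 4) (var s' 2) + S (arr s' 4) (var s' 3))].
apply: (wp_while M_lt (J := J) (m := fun s' => 2 * n - (var s' 2 + var s' 3))).
- split; [by kept| |by []].
  rewrite /bfs_st; st; split=> //.
  + by move=> [|k] //; rewrite upd_same.
  + by move=> [|k] [|k'].
  + move=> x xn; have [->|x0] := eqVneq x 0.
      by rewrite upd_same; split=> // _; exists 0; rewrite ?upd_same.
    rewrite upd_other // V0 //; split=> // -[[|k] //] _; rewrite upd_same => E.
    by rewrite -E eqxx in x0.
  + by move=> [|k].
  + by move=> [|k].
  + by move=> [|k] [|k'].
  + by move=> _ [|k].
  + by move=> [|k].
- by move=> t s'; rewrite /=.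
- move=> t s' [ik' b' t_le] /= /eqP; rewrite eqb0 -leqNgt => qi.
  rewrite /bfs_st in b'.
  have qj : var s' 3 = var s' 1.
    by apply/eqP; rewrite eqn_leq (b_jq b') (leq_trans qi (b_ij b')).
  have qi' : var s' 2 = var s' 1.
    by apply/eqP; rewrite eqn_leq qi -qj (b_ij b').
  have sum_le := bfs_deg_sum gr b' (leq0n _) (leqnn _).
  rewrite qi' qj in b' t_le; have [qn _] := bfs_inv_done gr b'.
  apply: wp_skip; rewrite qn in b' t_le sum_le; split=> //.
  by rewrite /S in t_le; nlia.
move=> t s' [ik' b' t_le] /= /eqP; rewrite eqb0 negbK => iq.
have := bfs_step_wp ik' b' iq; move/wp_mono; apply=> t1 s'' [m mq].
have [qn jq] : var s' 1 <= n /\ var s' 3 <= var s' 1.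
  by split; [apply: bfs_inv_qn b'|apply: b_jq b'].
move=> [ik'' b'' Qs t1_le cases].
have SE l : l <= var s' 1 -> S (arr s'' 4) l = S (arr s' 4) l.
  move=> lq; apply: eq_big_nat => k /andP[_ kl].
  by rewrite Qs // (leq_trans kl).
have Sr l : S (arr s' 4) l.+1 = S (arr s' 4) l + deg off (arr s' 4 l).
  by rewrite /S big_nat_recr.
have iq' := ltnW iq; rewrite /J; case: cases => -[mE [-> ->]]; rewrite mE in t1_le mq *.
  split; last by nlia.
  split=> //; rewrite !SE // Sr; nlia.
split; last by nlia.
split=> //; rewrite !SE // Sr; nlia.
Qed.

End BfsRun.

(** * The union-find invariant *)

Section Forest.
Variable n : nat.

(** [c] is a ghost map to the roots. Depth is not recorded: sizes at least double along each link,
    so a climb of k links reaches a size of at least 2 ^ k, while no size exceeds [n]. *)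
Record uf_forest (up sz c : nat -> nat) : Prop := UfForest {
  f_c : forall x, x < n -> [/\ c x < n, c (c x) = c x & up (c x) = c x];
  f_up : forall x, x < n -> [/\ up x < n, c (up x) = c x & up x = x -> c x = x];
  f_sz : forall x, x < n -> [/\ 0 < sz x, sz x <= n & up x <> x -> 2 * sz x <= sz (up x)];
  f_card : forall a, a < n -> c a = a -> sz a = count (fun x => c x == a) (iota 0 n) }.

Definition redirect (c : nat -> nat) g d x := if c x == d then g else c x.

Lemma uf_forest_init : uf_forest id (fun _ => 1) id.
Proof.
split=> //.
- by move=> x xn; split=> //; apply: leq_ltn_trans xn.
- by move=> a an _; rewrite (count_uniq_mem a (iota_uniq 0 n)) mem_iota add0n an.
Qed.

Lemma uf_forest_ext up sz c up' sz' : (forall x, x < n -> up' x = up x) ->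
  (forall x, x < n -> sz' x = sz x) -> uf_forest up sz c -> uf_forest up' sz' c.
Proof.
move=> Eu Es [fc fu fs fcd]; split.
- by move=> x xn; have [? ? ?] := fc x xn; rewrite Eu.
- by move=> x xn; rewrite Eu //; apply: fu.
- by move=> x xn; have [u _ _] := fu x xn; rewrite !Eu ?Es //; apply: fs.
- by move=> a an; rewrite Es //; apply: fcd.
Qed.

Lemma uf_forest_merge up sz c g d : uf_forest up sz c -> g < n -> d < n ->
    c g = g -> c d = d -> g <> d -> sz d <= sz g ->
  uf_forest (upd up d g) (upd sz g (sz g + sz d)) (redirect c g d).
Proof.
move=> F gn dn cg cd /eqP gd sz_le; rewrite /redirect.
have [_ _ upg] := f_c F gn; rewrite cg in upg.
have cnt : sz g + sz d = count (fun x => (if c x == d then g else c x) == g) (iota 0 n).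
  rewrite (f_card F gn cg) (f_card F dn cd) -count_predUI.
  rewrite [X in _ + X](_ : _ = 0).
    rewrite addn0; apply: eq_count => x /=.
    by have [->|] := eqVneq (c x) d; rewrite ?eqxx ?orbT ?orbF.
  apply/eqP; rewrite -leqn0 leqNgt -has_count; apply/hasP=> -[x _ /= /andP[/eqP-> /eqP E]].
  by rewrite E eqxx in gd.
split.
- move=> x xn; have [cn cc uc] := f_c F xn.
  case: (eqVneq (c x) d) => [_|cxd].
    by rewrite cg (negPf gd) upd_other.
  by rewrite cc (negPf cxd) upd_other.
- move=> x xn; have [un cu ux] := f_up F xn.
  have [->|xd] := eqVneq x d.
    by rewrite upd_same cg cd eqxx (negPf gd); split=> // E; rewrite E eqxx in gd.
  rewrite upd_other // cu; split=> // /ux E.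
  by rewrite E (negPf xd).
- move=> x xn; have [s0 sn su] := f_sz F xn.
  have cntn : sz g + sz d <= n by rewrite cnt -[leqRHS](size_iota 0) count_size.
  have [E|xd] := eqVneq x d.
    have dg : d != g by rewrite eq_sym.
    rewrite E in s0 sn *; rewrite upd_same (upd_other _ _ dg) upd_same.
    by split=> // _; rewrite mul2n -addnn leq_add2r.
  rewrite (upd_other _ _ xd); have [E|xg] := eqVneq x g.
    by rewrite E in s0 *; rewrite upg upd_same; split=> //; rewrite ltn_addr.
  rewrite (upd_other _ _ xg); split=> // /su le.
  rewrite /upd; case: eqP => // E; rewrite -E in sz_le *.
  exact: leq_trans le (leq_addr _ _).
- move=> a an; have [->|ag] := eqVneq a g; first by rewrite upd_same.
  rewrite upd_other //; case: eqP => [_ E|ne ca]; first by rewrite E eqxx in ag.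
  rewrite (f_card F) //; apply: eq_count => x /=.
  have [E|//] := eqVneq (c x) d; rewrite E eq_sym (negPf (_ : g != a)) 1?eq_sym //.
  by apply/eqP=> E'; rewrite -ca -E' cd in ne.
Qed.

End Forest.

(** * Classes and their representatives *)

Section UnionFind.
Variables (n : nat) (en : rel nat) (lev par : nat -> nat) (D : nat).
Hypothesis en_n : forall x y, en x y -> x < n /\ y < n.
Hypothesis en_s : symmetric en.
Hypothesis lev0 : lev 0 = 0.
Hypothesis n_gt0 : 0 < n.
Hypothesis par_en : forall x, x < n -> x <> 0 -> en x (par x) /\ lev x = (lev (par x)).+1.

(** The guard on [x] excludes the empty walk at a vertex above level [l], that is, with a smaller
    level. *)
Definition conn l x y := exists2 p,
  (l <= lev x) && path (within en (fun a => l <= lev a)) x p & last x p = y.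

Hypothesis close : forall x y, x < n -> y < n -> lev x = lev y -> conn (lev x) x y ->
  exists p, [/\ path en x p, last x p = y & size p <= D].

Definition walk fp k x y := exists p,
  [/\ path en x p, last x p = y & esum (indic (fun a b => ~~ zero_edge fp a b)) x p <= k].

Lemma conn_refl l x : l <= lev x -> conn l x x.
Proof. by move=> lx; exists [::]; rewrite ?lx. Qed.

Lemma conn_trans l x y z : conn l x y -> conn l y z -> conn l x z.
Proof.
move=> [p /andP[lx pp] <-] [q /andP[_ pq] <-]; exists (p ++ q).
  by rewrite lx cat_path pp.
by rewrite last_cat.
Qed.

Lemma conn_step l x y : en x y -> l <= lev x -> l <= lev y -> conn l x y.
Proof. by move=> exy lx ly; exists [:: y]; rewrite //= /within exy lx ly. Qed.

Lemma conn_ge l x y : conn l x y -> l <= lev x /\ l <= lev y.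
Proof.
move=> [p /andP[lx pp] <-]; split=> //.
elim: p x lx pp => //= y' p IH x lx /andP[/and3P[_ _ ly] /IH]; exact.
Qed.

Lemma conn_sym l x y : conn l x y -> conn l y x.
Proof.
move=> [p /andP[lx pp] <-]; elim: p x lx pp => [|z p IH] x lx /=.
  by move=> _; apply: conn_refl.
move=> /andP[/and3P[exz _ lz] /(IH z lz) h]; apply: conn_trans h _.
by apply: conn_step; rewrite // en_s.
Qed.

Lemma conn_le l l' x y : l' <= l -> conn l x y -> conn l' x y.
Proof.
move=> ll [p /andP[lx pp] lp]; exists p => //; rewrite (leq_trans ll) //=.
apply: sub_path pp => a b /and3P[eab la lb].
by rewrite /within eab !(leq_trans ll).
Qed.

Lemma walk_trans fp k k' x y z :
  walk fp k x y -> walk fp k' y z -> walk fp (k + k') x z.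
Proof.
move=> [p [pp <- sp]] [q [pq <- sq]]; exists (p ++ q).
by rewrite cat_path pp pq last_cat esum_cat leq_add.
Qed.

Lemma walk_mono fp fp' k k' x y : (forall a, fp a <> 0 -> fp' a = fp a) ->
  k <= k' -> walk fp k x y -> walk fp' k' x y.
Proof.
move=> ext kk [p [pp lp sp]]; exists p; split=> //.
apply: leq_trans kk; apply: leq_trans sp; apply: leq_esum pp => a b _.
rewrite /indic /zero_edge; case: (eqVneq (fp b) a.+1) => [E|_].
  by rewrite ext E // eqxx.
case: (eqVneq (fp a) b.+1) => [E|_]; last exact: leq_b1.
by rewrite (ext a) E // eqxx orbT.
Qed.

(* c maps a vertex to the root of its class, Pr holds of the processed
   vertices and H of the edges already used, l is the current level. *)
Record uf_inv (l : nat) (Pr : nat -> Prop) (H : nat -> nat -> Prop)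
    (fp rep sz c : nat -> nat) : Prop := UfInv {
  u_new : forall x, x < n -> ~ Pr x ->
    [/\ c x = x, rep x = x & forall y, y < n -> c y = x -> y = x];
  u_edge : forall x y, Pr x -> Pr y -> en x y -> H x y ->
    c x = c y /\ lev (rep (c x)) <= lev y;
  u_rep : forall x, x < n -> Pr x -> let p := rep (c x) in
    [/\ p < n, conn (lev p) x p, l <= lev p &
        walk fp (D * trunc_log 2 (sz (c x))) x p];
  u_free : forall y, y < n -> fp y <> 0 ->
    [/\ fp y = (par y).+1, y <> 0, Pr y & lev (rep (c y)) < lev y];
  u_uniq : forall x y, x < n -> y < n -> fp x <> 0 -> fp y <> 0 ->
    lev x = lev y -> conn (lev x) x y -> x = y }.

Lemma uf_weaken l Pr H H' fp rep sz c :
    (forall x y, Pr x -> Pr y -> en x y -> H' x y -> H x y) ->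
  uf_inv l Pr H fp rep sz c -> uf_inv l Pr H' fp rep sz c.
Proof.
move=> HH [un ue ur uf uu]; split=> // x y Px Py exy /(HH _ _ Px Py exy).
exact: ue.
Qed.

Lemma uf_start l l' Pr fp rep sz c v :
    uf_inv l Pr (fun _ _ => True) fp rep sz c -> v < n -> ~ Pr v ->
    lev v = l' -> l' <= l ->
  uf_inv l' (fun x => x = v \/ Pr x) (fun x y => x <> v /\ y <> v) fp rep sz c /\
  lev (rep (c v)) = l'.
Proof.
move=> [un ue ur uf uu] vn nv lv ll; have [cv rv _] := un v vn nv.
split; last by rewrite cv rv.
split=> //.
- by move=> x xn h; apply: un => // px; apply: h; right.
- by move=> x y [->|px] [->|py] exy [xv yv] //; apply: ue.
- move=> x xn [->|/(ur x xn)[? ? le ?]]; last by split=> //; apply: leq_trans le.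
  rewrite cv rv /=; split=> //; first exact: conn_refl.
    by rewrite lv.
  by exists [::].
- by move=> y yn /(uf y yn)[? ? ? ?]; split=> //; right.
Qed.

Section Step.
Variables (l v w : nat) (Pr : nat -> Prop) (H : nat -> nat -> Prop).
Variables (fp rep sz c : nat -> nat).
Hypotheses (vn : v < n) (wn : w < n) (Pv : Pr v) (Pw : Pr w) (lv : lev v = l).
Hypothesis inv : uf_inv l Pr H fp rep sz c.
Hypothesis Pr_lev : forall x, x < n -> l < lev x -> Pr x.
Hypothesis H_old : forall x y, x <> v -> y <> v -> H x y.

(** All vertices deeper than [l] are processed, and the edges between them avoid [v], so they have
    already been used. *)
Lemma uf_conn m x y : l < m -> conn m x y -> c x = c y.
Proof.
move=> lm [p /andP[mx pp] <-]; elim: p x mx pp => //= z p IH x mx.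
move=> /andP[/and3P[exz _ mz] /(IH _ mz) <-].
have [xn zn] := en_n exz.
have nev a : m <= lev a -> a <> v by move=> ma E; rewrite E lv leqNgt lm in ma.
have Px := Pr_lev xn (leq_trans lm mx); have Pz := Pr_lev zn (leq_trans lm mz).
by have [-> //] := u_edge inv Px Pz exz (H_old (nev _ mx) (nev _ mz)).
Qed.

Lemma lev_pos_neq0 p m : lev p = m.+1 -> p <> 0.
Proof. by move=> lp E; rewrite E lev0 in lp. Qed.

(** Otherwise the parent of the representative would also be deeper than [l], hence in the same
    class, and [u_edge] on the tree edge would put the representative no deeper than its own
    parent. *)
Lemma uf_rep_le : lev (rep (c w)) <= l.+1.
Proof.
rewrite leqNgt; apply/negP; set p := rep (c w) => lp.
have [pn cn _ _] := u_rep inv wn Pw; rewrite -/p in pn cn.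
have lp' : l < lev p by apply: ltnW.
have cp := uf_conn lp' cn.
have p0 : p <> 0 by move=> E; rewrite E lev0 in lp.
have [ep lpp] := par_en pn p0; have [_ ppn] := en_n ep.
have lpar : l < lev (par p) by rewrite lpp in lp.
have nev a : l < lev a -> a <> v by move=> la E; rewrite E lv ltnn in la.
have [_] := u_edge inv (Pr_lev pn lp') (Pr_lev ppn lpar) ep (H_old (nev _ lp') (nev _ lpar)).
by rewrite -cp -/p lpp ltnn.
Qed.

Lemma uf_lift : l < lev (rep (c w)) -> let p := rep (c w) in
  uf_inv l Pr H (upd fp p (par p).+1) (upd rep (c w) (par p)) sz c /\
  [/\ p < n, par p < n & lev (par p) = l].
Proof.
move=> lp0 p; rewrite -/p in lp0.
have lp : lev p = l.+1 by apply/eqP; rewrite eqn_leq uf_rep_le lp0.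
have [pn cn _ _] := u_rep inv wn Pw; rewrite -/p lp in pn cn.
have [ep lpp] := par_en pn (lev_pos_neq0 lp); have [_ ppn] := en_n ep.
have lpar : lev (par p) = l by move: lpp; rewrite lp => -[].
have cp : c p = c w by rewrite (uf_conn _ cn).
have Pp : Pr p by apply: Pr_lev; rewrite ?lp.
have nF : fp p = 0.
  apply/eqP; apply: contraT => /eqP /(u_free inv pn)[_ _ _].
  by rewrite cp -/p ltnn.
have ext a : fp a <> 0 -> upd fp p (par p).+1 a = fp a.
  by move=> fa; rewrite upd_other //; apply/eqP=> E; rewrite E in fa.
have fpp : upd fp p (par p).+1 p = (par p).+1 by rewrite upd_same.
have oldF y : y <> p -> upd fp p (par p).+1 y <> 0 -> fp y <> 0.
  by move=> /eqP yp; rewrite upd_other.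
(* A free edge going up from another vertex [y] of this cluster would, by [u_free], have raised the
   representative of the class above the level of [y], which is the level of [p]. *)
have noF y : y < n -> y <> p -> upd fp p (par p).+1 y <> 0 -> lev p = lev y ->
    conn (lev p) p y -> False.
  move=> yn yp /(oldF y yp) Fy lpy; rewrite lp => cpy.
  have [_ _ _] := u_free inv yn Fy.
  by rewrite -(uf_conn _ cpy) // cp -/p lpy ltnn.
split; last by split.
split.
- move=> x xn nPx; have [cx rx ux] := u_new inv xn nPx; split=> //.
  rewrite upd_other //; apply/eqP=> E; have := ux w wn (esym E).
  by move=> Ew; rewrite -Ew in nPx.
- move=> x y Px Py exy Hxy; have [cxy le] := u_edge inv Px Py exy Hxy.
  split=> //; rewrite /upd; case: eqP => // E.
  by rewrite lpar; move: le; rewrite E -/p lp; apply: ltnW.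
- move=> x xn Px /=; have [rn cr lr wr] := u_rep inv xn Px.
  have [E|ne] := eqVneq (c x) (c w).
    rewrite E upd_same lpar; rewrite E -/p lp in cr wr.
    split=> //.
      apply: conn_trans (conn_le (leqnSn l) cr) _.
      by apply: conn_step; rewrite ?lp ?lpar.
    rewrite -[_ * _]addn0; apply: walk_trans (walk_mono ext (leqnn _) wr) _.
    exists [:: par p]; rewrite /= ep; split=> //.
    by rewrite /indic /zero_edge fpp eqxx orbT.
  by rewrite upd_other //; split=> //; apply: walk_mono wr.
- move=> y yn Fy; have [E|/eqP yp] := eqVneq y p.
    rewrite E fpp cp upd_same lpar lp; split=> //; exact: lev_pos_neq0 lp.
  have [fy y0 Py ly] := u_free inv yn (oldF y yp Fy).
  rewrite upd_other; last by apply/eqP.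
  split=> //; rewrite /upd; case: eqP => // E.
  by rewrite lpar; move: ly; rewrite E -/p lp; apply: ltnW.
- move=> x y xn yn Fx Fy lxy cxy.
  have [Ex|/eqP xp] := eqVneq x p; have [Ey|/eqP yp] := eqVneq y p.
  + by rewrite Ex.
  + by rewrite Ex in lxy cxy; case: (noF y yn yp Fy lxy cxy).
  + rewrite Ey in lxy cxy; case: (noF x xn xp Fx (esym lxy)).
    by apply: conn_sym; rewrite -lxy.
  + by apply: (u_uniq inv) => //; apply: oldF.
Qed.

Lemma uf_link (H' : nat -> nat -> Prop) : en v w -> lev (rep (c v)) = l ->
    lev (rep (c w)) = l -> c v = c w ->
    (forall x y, H' x y -> H x y \/ (x = v /\ y = w) \/ (x = w /\ y = v)) ->
  uf_inv l Pr H' fp rep sz c.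
Proof.
move=> evw lrv lrw cvw HH; have [un ue ur uf uu] := inv; split=> //.
have lw : l <= lev w by have [_ /conn_ge[h _] _ _] := ur w wn Pw; rewrite -lrw.
move=> x y Px Py exy /HH[|[[-> ->]|[-> ->]]]; first exact: ue.
  by rewrite lrv.
by rewrite lrw lv.
Qed.

(** Both representatives are at level [l] and connected through the edge from [v] to [w] within the
    levels at least [l], so they share a cluster. Going from that of [d] to that of [g] costs at
    most [D]. *)
Lemma uf_merge g d : en v w -> lev (rep (c v)) = l -> lev (rep (c w)) = l ->
    (g = c v /\ d = c w) \/ (g = c w /\ d = c v) -> g <> d ->
    0 < sz d -> sz d <= sz g ->
  uf_inv l Pr H fp rep (upd sz g (sz g + sz d)) (redirect c g d).
Proof.
move=> evw lrv lrw gd /eqP ne sd0 sz_le; rewrite /redirect.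
have [rvn cv _ _] := u_rep inv vn Pv; rewrite lrv in cv.
have [rwn cw _ _] := u_rep inv wn Pw; rewrite lrw in cw.
have lw : l <= lev w by have [] := conn_ge cw.
have cvw : conn l v w by apply: conn_step; rewrite ?lv.
have [rgn rdn lg ld cdg] : [/\ rep g < n, rep d < n, lev (rep g) = l, lev (rep d) = l
    & conn l (rep d) (rep g)].
  case: gd => -[-> ->]; split=> //.
    by apply: conn_trans (conn_sym cw) (conn_trans (conn_sym cvw) cv).
  by apply: conn_trans (conn_sym cv) (conn_trans cvw cw).
have wdg : walk fp D (rep d) (rep g).
  have [|p [pp lp sp]] := close rdn rgn (etrans ld (esym lg)); first by rewrite ld.
  exists p; split=> //; apply: leq_trans sp; rewrite -(esum1 (rep d)).
  by apply: leq_esum pp => a b _; rewrite /indic leq_b1.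
have new x : x < n -> ~ Pr x -> x <> g /\ x <> d.
  move=> xn nPx; have [_ _ ux] := u_new inv xn nPx.
  have xcv : x <> c v by move=> /esym/(ux v vn) E; rewrite -E in nPx.
  have xcw : x <> c w by move=> /esym/(ux w wn) E; rewrite -E in nPx.
  by case: gd => -[-> ->].
split.
- move=> x xn nPx; have [cx rx ux] := u_new inv xn nPx.
  have [/eqP xg /eqP xd] := new x xn nPx.
  rewrite cx (negPf xd); split=> // y yn.
  by case: eqP => [_ E|_]; [rewrite E eqxx in xg|apply: ux].
- move=> x y Px Py exy Hxy; have [cxy le] := u_edge inv Px Py exy Hxy.
  by rewrite -cxy; split=> //; case: eqP le => // ->; rewrite lg ld.
- move=> x xn Px /=; have [rn cr lr wr] := u_rep inv xn Px.
  case: (eqVneq (c x) d) => [E|nd].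
    rewrite E ld in cr wr; rewrite upd_same lg; split=> //.
      exact: conn_trans cr cdg.
    apply: walk_mono (walk_trans wr wdg) => //.
    (* The class of a vertex that changes representative at least doubles in size: the logarithm
       gains 1, which pays for [D]. *)
    rewrite -mulnSr leq_mul2l; apply/orP; right.
    rewrite -(trunc_log2_double sd0) leq_trunc_log //.
    by rewrite -addnn leq_add2r.
  split=> //; rewrite /upd; case: eqP => // E; apply: walk_mono wr => //.
  by rewrite leq_mul2l E leq_trunc_log ?orbT // leq_addr.
- move=> y yn Fy; have [fy y0 Py ly] := u_free inv yn Fy; split=> //.
  by case: eqP ly => // ->; rewrite lg ld.
- exact: u_uniq inv.
Qed.

End Step.

Lemma uf_end l Pr fp rep sz c : uf_inv l Pr (fun _ _ => True) fp rep sz c ->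
    (forall x, x < n -> Pr x) -> (forall x, x < n -> sz (c x) <= n) ->
    (forall y, y < n -> exists2 p, path en 0 p & last 0 p = y) ->
  forall x, x < n -> walk fp (D * trunc_log 2 n) x 0.
Proof.
move=> inv allP szn conn0 x xn.
have c0 : c x = c 0.
  have [p pp <-] := conn0 x xn; elim/last_ind: p pp => // p y IH.
  rewrite rcons_path last_rcons => /andP[/IH <- epy].
  have [an bn] := en_n epy.
  by have [->] := u_edge inv (allP _ an) (allP _ bn) epy I.
have [rn cr _ _] := u_rep inv n_gt0 (allP _ n_gt0).
have [rx _ _ wx] := u_rep inv xn (allP x xn).
(* The class of 0 is connected to its representative without going above the latter, so the
   representative has level 0, and only 0 does. *)
have r0 : rep (c 0) = 0.
  have [h _] := conn_ge cr; rewrite lev0 leqn0 in h.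
  apply/eqP; apply: contraT => /eqP ne.
  by have [_ E] := par_en rn ne; rewrite E in h.
rewrite c0 r0 in wx; apply: walk_mono wx => //.
by rewrite leq_mul2l leq_trunc_log ?orbT // -c0 szn.
Qed.

End UnionFind.

(** * Execution of the union-find phase *)

(** There is no path compression: union by size already gives logarithmic climbs, and a search that
    writes no array leaves the invariants untouched. *)
Definition uf_find v x : cmd := Seq (Assign v (Var x))
  (While (Eq (Eq (Get 9 (Var v)) (Var v)) (Const 0)) (Assign v (Get 9 (Var v)))).

(* Arrays 9, 10 and 11 hold the union-find parents, the sizes and the
   representatives of the classes. *)
Definition uf_join : cmd := blk
  [:: uf_find 8 4;
      uf_find 9 7;
      If (Lt (Get 5 (Var 4)) (Get 5 (Get 11 (Var 9))))
        (blk [:: Assign 10 (Get 11 (Var 9));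
                 Put 8 (Var 10) (Add (Get 7 (Var 10)) (Const 1));
                 Put 11 (Var 9) (Get 7 (Var 10))]) Skip;
      If (Eq (Var 8) (Var 9)) Skip
        (If (Lt (Get 10 (Var 8)) (Get 10 (Var 9)))
          (Seq (Put 9 (Var 8) (Var 9))
               (Put 10 (Var 9) (Add (Get 10 (Var 9)) (Get 10 (Var 8)))))
          (Seq (Put 9 (Var 9) (Var 8))
               (Put 10 (Var 8) (Add (Get 10 (Var 8)) (Get 10 (Var 9))))))].

(** An edge is used when the second of its ends is processed; a nonzero flag postpones it. *)
Definition uf_scan : cmd := blk
  [:: Assign 7 (Get 1 (Var 6));
      Assign 6 (Add (Var 6) (Const 1));
      If (Get 6 (Var 7)) Skip uf_join].

(* Array 6 becomes the flag of the vertices still to be processed: it is back to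
   0 for the second breadth-first search. *)
Definition uf_step : cmd := blk
  [:: Assign 2 (Defs.Sub (Var 2) (Const 1));
      Assign 4 (Get 4 (Var 2));
      Put 6 (Var 4) (Const 0);
      Assign 6 (Get 0 (Var 4));
      While (Lt (Var 6) (Get 0 (Add (Var 4) (Const 1)))) uf_scan].

Definition uf : cmd := blk
  [:: Assign 2 (Const 0);
      While (Lt (Var 2) (Var 0)) (blk
        [:: Put 9 (Var 2) (Var 2); Put 10 (Var 2) (Const 1);
            Put 11 (Var 2) (Var 2); Assign 2 (Add (Var 2) (Const 1))]);
      While (Var 2) uf_step].

Lemma put_var_twice s v a b : put_var (put_var s v a) v b = put_var s v b.
Proof.
rewrite /put_var /=; congr State; apply/funext => j.
by case: (eqn j v).
Qed.

Lemma step_time K t d a o : t <= K * (a - o) -> o <= a -> d <= K ->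
  t + d <= K * (a.+1 - o).
Proof. by move=> t_le oa dK; rewrite subSn // mulnS addnC leq_add. Qed.

Section UfRun.
Variables (w M n D : nat) (en : rel nat) (off A Q lev par : nat -> nat).
Hypotheses (M_lt : M < 2 ^ w) (n_gt0 : 0 < n) (gr : nat_graph n en off A).
Hypotheses (n_lt : n + 3 <= M) (off_lt : off n < M).
Hypothesis lev0 : lev 0 = 0.
Hypothesis par_en : forall x, x < n -> x <> 0 -> en x (par x) /\ lev x = (lev (par x)).+1.
Hypothesis close : forall x y, x < n -> y < n -> lev x = lev y ->
  conn en lev (lev x) x y -> exists p, [/\ path en x p, last x p = y & size p <= D].
Hypothesis Q_lt : forall k, k < n -> Q k < n.
Hypothesis Q_inj : forall k k', k < n -> k' < n -> Q k = Q k' -> k = k'.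
Hypothesis Q_surj : forall x, x < n -> exists2 k, k < n & Q k = x.
Hypothesis Q_sorted : forall k k', k <= k' -> k' < n -> lev (Q k) <= lev (Q k').

Let L := trunc_log 2 n.

Lemma uf_find_wp v x c s : uf_forest n (arr s 9) (arr s 10) c -> var s x < n ->
  wp w (uf_find v x) s
    (fun t s' => t <= 12 * L + 20 /\ s' = put_var s v (c (var s x))).
Proof.
move=> F xn; apply: wp_seq; apply: (wp_assign M_lt); [by []|by []|].
(* [k] counts the links climbed; [2 ^ k] is at most a size, so [k] is at most [L]. *)
pose J t s' := exists y k, [/\ s' = put_var s v y, y < n, c y = c (var s x),
  2 ^ k <= arr s 10 y & t <= 12 * k].
apply: (wp_while M_lt (J := J) (m := fun s' => n - arr s 10 (var s' v))).
- by exists (var s x), 0; split=> //; case: (f_sz F xn).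
- by move=> t s' [y [k [-> yn cy k_le t_le]]]; fit_tac.
- move=> t s' [y [k [-> yn cy k_le t_le]]]; cbn [ev cost].
  rewrite !var_put_var !arr_put_var eqxx => /eqP.
  rewrite !eqb0 => /negPn/eqP E.
  have [_ sn _] := f_sz F yn; have [_ _ /(_ E) cyy] := f_up F yn.
  rewrite -cy cyy; split=> //.
  have kL : k <= L by apply: trunc_log_max => //; apply: leq_trans sn.
  by nlia.
move=> t s' [y [k [-> yn cy k_le t_le]]]; cbn [ev cost].
rewrite !var_put_var !arr_put_var eqxx => /eqP.
rewrite !eqb0 => /negPn/eqP ne.
have [un cu _] := f_up F yn; have [_ sn /(_ ne) su] := f_sz F yn.
have [_ su_n _] := f_sz F un; have [sy0 _ _] := f_sz F yn.
apply: (wp_assign M_lt (v := arr s 9 y)); first by [].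
  by cbn [ev]; rewrite var_put_var arr_put_var eqxx.
rewrite put_var_twice !var_put_var eqxx; split; last by nlia.
exists (arr s 9 y), k.+1; split=> //; first by rewrite cu.
  by rewrite expnS; nlia.
by cbn [cost]; nlia.
Qed.

Definition uf_fixed (s : state) :=
  [/\ var s 0 = n, arr s 0 = off, arr s 1 = A, arr s 4 = Q &
      arr s 5 = lev /\ arr s 7 = par].

Lemma uf_fixed_var s i v : i != 0 -> uf_fixed s -> uf_fixed (put_var s i v).
Proof. by move=> i0 [? ? ? ? ?]; split; rewrite ?stE // eq_sym (negPf i0). Qed.

Lemma uf_fixed_arr s a i v :
  a \notin [:: 0; 1; 4; 5; 7] -> uf_fixed s -> uf_fixed (put_arr s a i v).
Proof.
rewrite !inE !negb_or => /and5P[a0 a1 a4 a5 a7] [? ? ? ? ?].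
by split; rewrite ?stE // !(eq_sym _ a) ?(negPf a0) ?(negPf a1) ?(negPf a4)
  ?(negPf a5) ?(negPf a7).
Qed.

Ltac fixed := repeat first [by []
  | apply: uf_fixed_var; [by []|] | apply: uf_fixed_arr; [by []|]].

Definition uf_st s l Pr H c :=
  uf_forest n (arr s 9) (arr s 10) c /\
  uf_inv n en lev par D l Pr H (arr s 8) (arr s 11) (arr s 10) c.

Section Join.
Variables (l v y : nat) (Pr : nat -> Prop) (H H' : nat -> nat -> Prop).
Hypotheses (vn : v < n) (Pv : Pr v) (lv : lev v = l) (evy : en v y) (Py : Pr y).
Hypothesis Pr_lev : forall x, x < n -> l < lev x -> Pr x.
Hypothesis H_old : forall x y, x <> v -> y <> v -> H x y.
Hypothesis HH : forall x x', H' x x' -> H x x' \/ (x = v /\ x' = y) \/ (x = y /\ x' = v).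

Lemma uf_join_wp s c : uf_fixed s -> var s 4 = v -> var s 7 = y ->
    uf_st s l Pr H c -> lev (arr s 11 (c v)) = l ->
  wp w uf_join s (fun t s' => t <= 24 * L + 120 /\
    [/\ uf_fixed s', arr s' 6 = arr s 6, var s' 2 = var s 2,
        var s' 4 = v /\ var s' 6 = var s 6 &
        exists2 c', uf_st s' l Pr H' c' & lev (arr s' 11 (c' v)) = l]).
Proof.
move=> fx z4 y7 [F inv] lrv.
have [_ yn] := en_lt gr evy.
have wfix := fx; case: wfix => n0 o0 A0 Q0 [l5 p7].
rewrite /uf_join; apply: wp_seq.
apply: wp_mono (uf_find_wp 8 F (_ : var s 4 < n)) _ => [|t1 _ [t1_le ->]]; first by rewrite z4.
rewrite z4; set s1 := put_var s 8 _.
have F1 : uf_forest n (arr s1 9) (arr s1 10) c by [].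
apply: wp_seq.
apply: wp_mono (uf_find_wp 9 F1 (_ : var s1 7 < n)) _ => [|t2 _ [t2_le ->]].
  by rewrite /s1; st; rewrite y7.
have -> : var s1 7 = y by rewrite /s1; st.
rewrite /s1 {F1 s1}; set s2 := put_var _ 9 _.
have en_n := en_lt gr; have en_s := en_sym gr.
have [ryn _ lry _] := u_rep inv yn Py.
pose kept s' := [/\ uf_fixed s', arr s' 6 = arr s 6, var s' 2 = var s 2,
  var s' 4 = v & var s' 6 = var s 6].
have wp_lift : wp w (If (Lt (Get 5 (Var 4)) (Get 5 (Get 11 (Var 9))))
     (blk [:: Assign 10 (Get 11 (Var 9));
              Put 8 (Var 10) (Add (Get 7 (Var 10)) (Const 1));
              Put 11 (Var 9) (Get 7 (Var 10))]) Skip) s2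
   (fun t s' => [/\ t <= 40, kept s', var s' 8 = c v, var s' 9 = c y &
      [/\ uf_st s' l Pr H c, lev (arr s' 11 (c v)) = l & lev (arr s' 11 (c y)) = l]]).
  apply: (wp_if M_lt); first by [].
    rewrite /s2; st; rewrite l5 z4 lv => /eqP; rewrite eqb0 negbK => lt_l.
    have [inv' [rn pn lp]] := uf_lift en_n en_s lev0 par_en yn Py lv inv Pr_lev H_old lt_l.
    have fitp : arr s 7 (arr s 11 (c y)) + 1 <= M by rewrite p7; nlia.
    wp_straight M_lt; split.
    - by [].
    - split; [by fixed|by []..].
    - by st.
    - by st.
    st; rewrite p7 addn1; split; first by split.
      by rewrite /upd; case: eqP.
    by rewrite upd_same.
  rewrite /s2; st; rewrite l5 z4 lv => /eqP; rewrite eqb0 -leqNgt => le_l.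
  wp_straight M_lt; split=> //.
  by st; split=> //; apply/eqP; rewrite eqn_leq le_l.
apply: wp_seq; apply: wp_mono wp_lift _ => t3 s3 [t3_le [fx3 s36 s32 s34 s36'] s38 s39 [[F3 inv3] lrv3 lry3]].
have [cvn cvv _] := f_c F3 vn; have [cyn cyy _] := f_c F3 yn.
have [sv0 svn _] := f_sz F3 cvn; have [sy0 syn _] := f_sz F3 cyn.
apply: wp_seq; apply: (wp_if M_lt); first by [].
  st; rewrite s38 s39 => /eqP; rewrite eqb0 negbK => /eqP cvy.
  wp_straight M_lt; split; first by st; nlia.
  split=> //; exists c => //; split=> //.
  exact: (uf_link yn Py lv inv3 evy lrv3 lry3 cvy HH).
st; rewrite s38 s39 => /eqP; rewrite eqb0 => /eqP cvy.
have ne' : c y <> c v by move=> E; apply: cvy.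
apply: (wp_if M_lt); first by [].
  st; rewrite s38 s39 => /eqP; rewrite eqb0 negbK => lt_s.
  have F4 := uf_forest_merge F3 cyn cvn cyy cvv ne' (ltnW lt_s).
  have [_ fitS _] := f_sz F4 cyn; rewrite upd_same in fitS.
  have fitS' : arr s3 10 (var s3 9) + arr s3 10 (var s3 8) <= M by rewrite s38 s39; nlia.
  wp_straight M_lt; split; first by st; nlia.
  split; [by fixed|exact: s36|exact: s32|by split|]; st.
  rewrite s38 s39; exists (redirect c (c y) (c v)); last first.
    by rewrite /redirect eqxx.
  split; first exact: F4.
  have inv4 := uf_merge en_s close vn yn Pv Py lv inv3 evy lrv3 lry3
    (or_intror (conj erefl erefl)) ne' sv0 (ltnW lt_s).
  apply: (uf_link yn Py lv inv4 evy _ _ _ HH); rewrite /redirect ?eqxx ?lry3 //.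
    by case: eqP.
  by case: eqP.
st; rewrite s38 s39 => /eqP; rewrite eqb0 -leqNgt => le_s.
have F4 := uf_forest_merge F3 cvn cyn cvv cyy cvy le_s.
have [_ fitS _] := f_sz F4 cvn; rewrite upd_same in fitS.
have fitS' : arr s3 10 (var s3 8) + arr s3 10 (var s3 9) <= M by rewrite s38 s39; nlia.
wp_straight M_lt; split; first by st; nlia.
split; [by fixed|exact: s36|exact: s32|by split|]; st.
have cvy' : (c v == c y) = false by apply/eqP.
rewrite s38 s39; exists (redirect c (c v) (c y)); last first.
  by rewrite /redirect cvy'.
split; first exact: F4.
have inv4 := uf_merge en_s close vn yn Pv Py lv inv3 evy lrv3 lry3
  (or_introl (conj erefl erefl)) cvy sy0 le_s.
by apply: (uf_link yn Py lv inv4 evy _ _ _ HH); rewrite /redirect ?eqxx ?cvy'.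
Qed.

End Join.

Definition processed (V : nat -> nat) x := x < n /\ V x = 0.

Definition scanned v k x y := (x <> v /\ y <> v) \/
  exists2 k', off v <= k' < k & (x = v /\ y = A k') \/ (x = A k' /\ y = v).

Definition uf_scan_inv v i V t s := [/\ uf_fixed s, arr s 6 = V, var s 2 = i,
  [/\ var s 4 = v, off v <= var s 6 <= off v.+1 &
      t <= (24 * L + 150) * (var s 6 - off v)] &
  exists2 c, uf_st s (lev v) (processed V) (scanned v (var s 6)) c &
    lev (arr s 11 (c v)) = lev v].

Lemma uf_scan_wp v i V t s : v < n -> V v = 0 ->
    (forall x, x < n -> lev v < lev x -> V x = 0) ->
    uf_scan_inv v i V t s -> var s 6 < off v.+1 ->
  wp w uf_scan s (fun t' s' => uf_scan_inv v i V (t + 6 + t').+1 s' /\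
    var s' 6 = (var s 6).+1).
Proof.
move=> vn Vv V_lev [fx V6 i2 [v4 k6 t_le] [c [F inv] lrv]] lt_k.
have [n0 o0 A0 Q0 [l5 p7]] := fx.
have off_n := off_le gr vn (leqnn n).
have kv : off v <= var s 6 < off v.+1 by case/andP: k6 => ->.
have evy := adj_en gr vn kv; have [_ yn] := en_lt gr evy.
have kM : var s 6 + 1 <= M by nlia.
have sub x x' : scanned v (var s 6 + 1) x x' -> scanned v (var s 6) x x' \/
    (x = v /\ x' = A (var s 6)) \/ (x = A (var s 6) /\ x' = v).
  case=> [|[k' /andP[ok]]]; first by left; left.
  rewrite addn1 ltnS leq_eqVlt => /predU1P[-> h|lt h]; first by right.
  by left; right; exists k'; rewrite ?ok.
apply: wp_seq; apply: (wp_assign M_lt (v := A (var s 6))); [by []|by st; rewrite A0|].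
wp_straight M_lt; apply: (wp_if M_lt); first by [].
  st; rewrite V6 => Vy; wp_straight M_lt; split; last by st; rewrite addn1.
  split; [by fixed|exact: V6|exact: i2| |].
    st; split=> //; rewrite [var s 6 + 1]addn1; first by case/andP: kv => *; nlia.
    apply: leq_trans (step_time (d := 100) t_le _ _); [nlia|by case/andP: k6|nlia].
  exists c => //; split; first exact: F.
  apply: (uf_weaken _ inv) => x x' [xn Vx] [xn' Vx'] exx'; st => /sub[//|].
  case=> -[E E']; first by rewrite -E' Vx' in Vy.
  by rewrite -E Vx in Vy.
st; rewrite V6 => Vy.
set s1 := put_var _ 6 _.
have fx1 : uf_fixed s1 by rewrite /s1; fixed.
have Pv : processed V v by split.
have Py : processed V (A (var s 6)) by split.
have V_lev' x : x < n -> lev v < lev x -> processed V x by move=> xn lx; split=> //; apply: V_lev.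
have H_old x y : x <> v -> y <> v -> scanned v (var s 6) x y by left.
have join := uf_join_wp vn Pv erefl evy Py V_lev' H_old sub fx1 v4 erefl (conj F inv) lrv.
apply: wp_mono join _ => t1 s2 [t1_le [fx2 s26 s22 [s24 s2k] [c' st2 lrv2]]].
apply: wp_skip; split; last by rewrite s2k /s1; st; rewrite addn1.
split; [by []|by rewrite s26|by rewrite s22| |].
  rewrite s24 s2k /s1; st; split=> //; rewrite [var s 6 + 1]addn1.
    by case/andP: kv => *; nlia.
  apply: leq_trans (step_time (d := 24 * L + 150) t_le _ _); [nlia|by case/andP: k6|nlia].
by exists c' => //; rewrite s2k.
Qed.

(** The queue is consumed from its end, so the processed vertices, whose flag is 0, form a final
    segment of it, and each has paid for its degree. *)
Definition uf_outer_inv t s := [/\ uf_fixed s, var s 2 <= n,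
  forall k, k < n -> (arr s 6 (Q k) = 0 <-> var s 2 <= k),
  t <= (24 * L + 150) * \sum_(var s 2 <= k < n) deg off (Q k) + 50 * (n - var s 2) &
  exists l c, (forall k, k < var s 2 -> lev (Q k) <= l) /\
    uf_st s l (processed (arr s 6)) (fun _ _ => True) c].

Lemma uf_step_wp t s : uf_outer_inv t s -> 0 < var s 2 ->
  wp w uf_step s (fun t' s' => uf_outer_inv (t + 1 + t').+1 s' /\
    var s' 2 < var s 2).
Proof.
move=> [fx i_n Vi t_le [l [c [l_ge [F inv]]]]] i0.
have [n0 o0 A0 Q0 [l5 p7]] := fx.
set i := (var s 2).-1; have iE : var s 2 - 1 = i by rewrite subn1.
have iS : var s 2 = i.+1 by rewrite prednK.
have iltn : i < n by rewrite -iS.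
set v := Q i; have vn : v < n := Q_lt iltn.
have off_n := off_le gr vn (leqnn n); have off_v := off_mono gr vn.
apply: wp_seq; apply: (wp_assign M_lt (v := i)); [by fit_tac|by []|].
apply: wp_seq; apply: (wp_assign M_lt (v := v)); [by []|by st; rewrite Q0|].
apply: wp_seq; apply: (wp_put M_lt (i := v) (v := 0)) => //.
apply: wp_seq; apply: (wp_assign M_lt (v := off v)); [by []|by st; rewrite o0|].
set s1 := put_var _ 6 _.
set V := upd (arr s 6) v 0.
have nPv : ~ processed (arr s 6) v.
  by move=> [_ /(Vi i iltn)]; rewrite iS ltnn.
have lev_il : lev v <= l by apply: l_ge; rewrite iS.
have [inv1 lrv] := uf_start inv vn nPv erefl lev_il.
have PE : (fun x => x = v \/ processed (arr s 6) x) = processed V.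
  apply/funext=> x; apply/propext; rewrite /processed /V; split.
    case=> [->|[xn Vx]]; first by rewrite upd_same.
    by split=> //; rewrite /upd; case: eqP.
  move=> [xn]; have [->|/eqP xv] := eqVneq x v; first by left.
  by rewrite upd_other; [right|apply/eqP].
have V_k k : k < n -> (V (Q k) = 0 <-> i <= k).
  move=> kn; rewrite /V; have [->|ki] := eqVneq k i.
    by rewrite upd_same leqnn.
  rewrite upd_other; last by apply: contra_neq ki => /Q_inj; apply.
  by rewrite (Vi k kn) iS [i <= k]leq_eqVlt eq_sym (negPf ki).
(* The queue is sorted by level: deeper vertices come later and are thus already processed. *)
have V_lev x : x < n -> lev v < lev x -> V x = 0.
  move=> xn; have [k kn <-] := Q_surj xn => lk; apply/(V_k k kn).
  by rewrite leqNgt; apply: contraL lk => ki; rewrite -leqNgt Q_sorted // ltnW.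
have inv_s1 : uf_scan_inv v i V 0 s1.
  split; [by rewrite /s1; fixed|by []|by []| |].
    by rewrite /s1; st; rewrite leqnn off_v.
  exists c => //; split; first exact: F.
  rewrite -PE; apply: (uf_weaken _ inv1) => x y _ _ _ [//|[k']].
  by rewrite /s1; st; rewrite leqNgt; case: (k' < _).
apply: wp_seq; apply: (wp_while M_lt (J := uf_scan_inv v i V) (m := fun s' => off v.+1 - var s' 6)) => //.
- by move=> t' s' [fx' _ _ [v4 k6 _] _]; rewrite /=; split=> //; split=> //; [nlia|rewrite v4; nlia].
- move=> t' s' [fx' V6 i2 [v4 k6 t'_le] [c' [F' inv'] _]]; have [_ o0' _ _ _] := fx'.
  cbn [ev cost]; rewrite o0' v4 addn1 => /eqP; rewrite eqb0 -leqNgt => k_ge.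
  have kE : var s' 6 = off v.+1 by apply/eqP; rewrite eqn_leq k_ge andbT; case/andP: k6.
  apply: wp_skip; split; last by rewrite i2 iS.
  rewrite /uf_outer_inv V6 i2; split=> //; first exact: ltnW.
  + rewrite (@big_ltn _ _ _ i) // -/v; rewrite iS in t_le; rewrite kE in t'_le.
    rewrite -/(deg off v) in t'_le; cbn [cost].
    have : n - i = (n - i.+1).+1 by rewrite subnSK.
    move: t_le t'_le; rewrite !mulnDr.
    move: ((24 * L + 150) * _) ((24 * L + 150) * _) => X Y; nlia.
  + exists (lev v), c'; split.
      by move=> k ki; apply: Q_sorted => //; apply: ltnW.
    split=> //; apply: (uf_weaken _ inv') => x y _ _ exy _.
    have [E|/eqP xv] := eqVneq x v.
      rewrite E in exy *; have [k' k'v <-] := en_adj gr exy.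
      by right; exists k'; [rewrite kE|left].
    have [E|/eqP yv] := eqVneq y v; last by left.
    rewrite E (en_sym gr) in exy *; have [k' k'v <-] := en_adj gr exy.
    by right; exists k'; [rewrite kE|right].
- move=> t' s' inv'; have [fx' _ _ [v4 k6 _] _] := inv'; have [_ o0' _ _ _] := fx'.
  cbn [ev cost]; rewrite o0' v4 addn1 => /eqP; rewrite eqb0 negbK => lt_k.
  have Vv : V v = 0 by rewrite /V upd_same.
  apply: wp_mono (uf_scan_wp vn Vv V_lev inv' lt_k) _ => t2 s2 [inv2 k2].
  by split; [exact: inv2|rewrite k2; nlia].
Qed.

Lemma uf_wp s : uf_fixed s -> (forall x, arr s 8 x = 0) ->
    (forall x, x < n -> arr s 6 x <> 0) ->
  wp w uf s (fun t' s' => [/\ uf_fixed s', forall x, x < n -> arr s' 6 x = 0,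
    t' <= (24 * L + 150) * off n + 100 * n + 20,
    forall x, x < n -> walk en (arr s' 8) (D * L) x 0 &
    (forall y, y < n -> arr s' 8 y <> 0 -> arr s' 8 y = (par y).+1 /\ y <> 0) /\
    forall x y, x < n -> y < n -> arr s' 8 x <> 0 -> arr s' 8 y <> 0 ->
      lev x = lev y -> conn en lev (lev x) x y -> x = y]).
Proof.
move=> fx fp0 V1; wp_straight M_lt.
pose J t s' := [/\ uf_fixed s', arr s' 6 = arr s 6 /\ arr s' 8 = arr s 8,
  var s' 2 <= n, t <= 30 * var s' 2 &
  forall x, x < var s' 2 -> [/\ arr s' 9 x = x, arr s' 10 x = 1 & arr s' 11 x = x]].
apply: (wp_while M_lt (J := J) (m := fun s' => n - var s' 2)).
- by split=> //; fixed.
- by move=> t s' _; fit_tac.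
- move=> t s' [fx' [V6 f8] i_n t_le init]; have [n0 _ _ _ _] := fx'.
  cbn [ev]; rewrite n0 => /eqP; rewrite eqb0 -leqNgt => i_ge.
  have iE : var s' 2 = n by apply/eqP; rewrite eqn_leq i_n.
  rewrite iE in t_le init.
  pose J2 t0 s2 := uf_outer_inv t0 s2.
  apply: wp_seq; apply: (wp_while M_lt (J := J2) (m := fun s2 => var s2 2)).
  + split; [by []|by rewrite iE| |by []|].
      move=> k kn; rewrite iE leqNgt kn V6; split=> // E.
      by have := V1 _ (Q_lt kn).
    exists (lev (Q n.-1)), id; split.
      by rewrite iE => k kn; apply: Q_sorted; rewrite ?ltn_predL // -ltnS prednK.
    have nP x : ~ processed (arr s' 6) x.
      by move=> [xn]; rewrite V6; apply: V1.
    split.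
      by apply: uf_forest_ext (uf_forest_init n) => x /init[].
    split.
    * by move=> x xn _; have [_ _] := init x xn.
    * by move=> x y /nP.
    * by move=> x _ /nP.
    * by move=> y _; rewrite f8 fp0.
    * by move=> x y _ _; rewrite f8 fp0.
  + by move=> t0 s2 _.
  + move=> t0 s2 [fx2 _ Vi t0_le [l [c [_ [F inv]]]]] /= i2.
    rewrite i2 in t0_le Vi.
    have V0 x : x < n -> arr s2 6 x = 0.
      by move=> /Q_surj[k kn <-]; apply/(Vi k kn).
    have P x : x < n -> processed (arr s2 6) x by move=> xn; split=> //; apply: V0.
    have szn x : x < n -> arr s2 10 (c x) <= n.
      by move=> xn; have [cn _ _] := f_c F xn; have [] := f_sz F cn.
    apply: wp_skip; split=> //.
    * have us : uniq (map Q (iota 0 n)).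
        rewrite map_inj_in_uniq ?iota_uniq // => k k'.
        by rewrite !mem_iota !add0n; apply: Q_inj.
      have lt_Q : {in map Q (iota 0 n), forall x, x < n}.
        by move=> x /mapP[k]; rewrite mem_iota add0n => kn ->; apply: Q_lt.
      have := sum_uniq_le (deg off) us lt_Q; rewrite big_map -(off_sum gr) //.
      have -> : iota 0 n = index_iota 0 n by rewrite /index_iota subn0.
      move=> le_off; have := leq_mul (leqnn (24 * L + 150)) le_off.
      move: t0_le; rewrite subn0; cbn [cost].
      move: ((24 * L + 150) * _) ((24 * L + 150) * _) => X Y; nlia.
    * exact: (uf_end (en_lt gr) lev0 n_gt0 par_en inv P szn (en_conn gr)).
    split; last exact: u_uniq inv.
    by move=> y yn /(u_free inv yn)[].
  + move=> t0 s2 J2s /= /eqP; rewrite -lt0n => i0.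
    exact: uf_step_wp J2s i0.
move=> t s' [fx' [V6 f8] i_n t_le init]; have [n0 _ _ _ _] := fx'.
cbn [ev]; rewrite n0 => /eqP; rewrite eqb0 negbK => i_lt.
have iM : var s' 2 + 1 <= M by nlia.
wp_straight M_lt; split; last by st; nlia.
split; [by fixed|by []|by st; nlia|by st; nlia|].
st => x; rewrite addn1 ltnS leq_eqVlt => /predU1P[->|lt]; first by rewrite !upd_same.
by rewrite !upd_other ?neq_ltn ?lt //; apply: init.
Qed.

End UfRun.

(** * Parent trees and the input *)

Section ParentTree.
Variables (V : finType) (r : V) (P : V -> V) (h : V -> nat).
Hypothesis h_lt : forall x, x != r -> h (P x) < h x.

Definition parent_graph : rel V :=
  fun x y => ((x != r) && (P x == y)) || ((y != r) && (P y == x)).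

(** On a cycle, both neighbours of a vertex of greatest [h] would be its parent. *)
Lemma parent_tree : is_tree parent_graph.
Proof.
have sym : symmetric parent_graph by move=> x y; rewrite /parent_graph orbC.
split.
- split=> // x; rewrite /parent_graph orbb; apply/negP=> /andP[/h_lt lt /eqP E].
  by rewrite E ltnn in lt.
- split; first by apply/card_gt0P; exists r.
  have to_r x : connect parent_graph x r.
    have [m] := ubnP (h x); elim: m x => // m IH x lt.
    have [->|xr] := eqVneq x r; first exact: connect0.
    apply: connect_trans (IH (P x) _).
      by apply: connect1; rewrite /parent_graph xr eqxx.
    exact: leq_trans (h_lt xr) lt.
  move=> x y; apply: connect_trans (to_r x) _.
  by rewrite (sym_connect_sym sym).
- move=> p up; rewrite leqNgt; apply/negP=> p_gt2.
  have [x0 x0p] : exists x, x \in p.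
    by case: (p) p_gt2 => // a s _; exists a; rewrite mem_head.
  have [x xp max] := @arg_maxnP V x0 (mem p) h x0p.
  have [i q rotE] := rot_to xp.
  have : ucycle parent_graph (rot i p) by rewrite rot_ucycle.
  have : 2 < size (rot i p) by rewrite size_rot.
  have max' a : a \in rot i p -> h a <= h x by rewrite mem_rot; apply: max.
  rewrite rotE in max' *; case: q rotE max' => [|y [|z q]] //= _ max' _.
  have toP a : a \in [:: x, y, z & q] -> parent_graph x a -> P x = a.
    move=> /max' le /orP[/andP[_ /eqP//]|/andP[/h_lt lt /eqP E]].
    by rewrite E ltnNge le in lt.
  rewrite /ucycle 2!cons_uniq => /andP[cyc /and3P[_ yzq _]].
  move: cyc => /= /and3P[exy _]; rewrite rcons_path => /andP[_ elx]; have lq : last z q \in z :: q by apply: mem_last.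
  have lx : last z q \in [:: x, y, z & q] by rewrite !inE -in_cons lq !orbT.
  have Py := toP y _ exy; have Pz := toP (last z q) lx (etrans (sym _ _) elx).
  have yl : y = last z q by rewrite -Pz -Py // !inE eqxx orbT.
  by rewrite -yl (negPf yzq) in lq.
Qed.

End ParentTree.

Lemma sym_walk_esum (T : eqType) (e : rel T) (f : T -> T -> nat) x p :
  symmetric e -> (forall a b, f a b = f b a) -> path e x p ->
  exists q, [/\ path e (last x p) q, last (last x p) q = x
             & esum f (last x p) q = esum f x p].
Proof.
move=> e_sym f_sym; elim: p x => [|y p IH] x /=; first by exists [::].
case/andP=> exy /IH[q [pq lq sq]]; exists (rcons q x).
rewrite rcons_path pq lq last_rcons e_sym; split=> //.
by rewrite -cats1 esum_cat sq /= lq addn0 f_sym addnC.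
Qed.

Section Size.
Variables (V : finType) (e : rel V).
Hypothesis e_simple : simple_graph e.

(** [h] serves to orient edges: the ordered pairs split into increasing and decreasing ones, and
    each half injects into the edge set. *)
Lemma degree_sum (h : V -> nat) : injective h ->
  \sum_(u : V) #|[pred v | e u v]| <= 2 * graph_size e.
Proof.
move=> h_inj; have [e_sym e_irr] := e_simple.
pose E (b : bool) := [set p : V * V | e p.1 p.2 && ((h p.1 < h p.2) == b)].
have le_E b : #|E b| <= graph_size e.
  rewrite -(@card_in_imset _ _ (fun p : V * V => [set p.1; p.2])) => [|[u v] [u' v']].
    apply: subset_leq_card; apply/subsetP=> A /imsetP[p].
    by rewrite inE => /andP[ep _] ->; apply/imsetP; exists p; rewrite ?inE.
  rewrite !inE /= => /andP[euv /eqP b1] /andP[_ /eqP b2] E12.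
  have : u' \in [set u; v] by rewrite E12 !inE eqxx.
  have : v' \in [set u; v] by rewrite E12 !inE eqxx orbT.
  have : u \in [set u'; v'] by rewrite -E12 !inE eqxx.
  have : v \in [set u'; v'] by rewrite -E12 !inE eqxx orbT.
  rewrite !inE => /orP[] /eqP Ev /orP[] /eqP Eu _ _.
  - by rewrite Ev Eu e_irr in euv.
  - rewrite -Ev -Eu -b1 in b2; exfalso; move: b2.
    by case: (ltngtP (h u) (h v)) => // /h_inj uv; rewrite uv e_irr in euv.
  - by rewrite Eu Ev.
  - by rewrite Ev Eu e_irr in euv.
have -> : \sum_(u : V) #|[pred v | e u v]| = #|[set p : V * V | e p.1 p.2]|.
  rewrite -sum1_card (eq_bigl (fun p => true && e p.1 p.2)); last by move=> p; rewrite inE.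
  rewrite -(pair_big_dep xpredT e (fun _ _ => 1)) /=; apply: eq_bigr => u _.
  by rewrite sum1_card.
have -> : [set p : V * V | e p.1 p.2] = E true :|: E false.
  by apply/setP=> p; rewrite !inE -andb_orr; case: (_ < _); rewrite ?andbT.
apply: leq_trans (leq_card_setU _ _) _.
by rewrite mul2n -addnn leq_add.
Qed.

End Size.

Section Input.
Variables (n : nat) (e : rel 'I_n) (adj : 'I_n -> seq 'I_n).
Hypotheses (e_simple : simple_graph e) (e_conn : connected_graph e).
Hypothesis adjP : adjacency_lists e adj.

Definition nat_rel : rel nat := fun x y =>
  [exists u : 'I_n, exists v : 'I_n, [&& val u == x, val v == y & e u v]].

Lemma nat_relP (u v : 'I_n) : nat_rel (val u) (val v) = e u v.
Proof.
apply/existsP/idP=> [[u' /existsP[v' /and3P[/eqP/val_inj-> /eqP/val_inj-> //]]]|euv].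
by exists u; apply/existsP; exists v; rewrite !eqxx.
Qed.

Lemma nat_rel_ex x y : nat_rel x y -> exists u v : 'I_n, [/\ x = val u, y = val v & e u v].
Proof.
by case/existsP=> u /existsP[v /and3P[/eqP<- /eqP<- euv]]; exists u, v.
Qed.

Lemma nat_path (u : 'I_n) (p : seq nat) : path nat_rel (val u) p ->
  exists2 q : seq 'I_n, p = map val q & path e u q.
Proof.
elim: p u => [|y p IH] u /=; first by exists [::].
case/andP=> /[dup] /nat_rel_ex[_ [v [_ -> _]]].
rewrite nat_relP => euv /IH[q -> pq]; exists (v :: q) => //=.
by rewrite euv.
Qed.

Lemma path_nat (u : 'I_n) (q : seq 'I_n) : path e u q -> path nat_rel (val u) (map val q).
Proof. by rewrite path_map; apply: sub_path => a b; rewrite /= nat_relP. Qed.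

Let lists := [seq [seq val v | v <- adj u] | u <- enum 'I_n].
Let off := arr (input_state adj) 0.
Let A := arr (input_state adj) 1.

Lemma size_lists : size lists = n.
Proof. by rewrite /lists size_map size_enum_ord. Qed.

Lemma input_off k : k <= n -> off k = sumn (take k (map size lists)).
Proof.
have main (s : seq nat) a i : i <= size s ->
    nth 0 (a :: scanl addn a s) i = a + sumn (take i s).
  elim: s a i => [|x s IH] a [|i] //=; rewrite ?addn0 // ltnS => le_i.
  by have /= -> := IH (a + x) i le_i; rewrite addnA.
move=> kn; rewrite /off /= -/lists main ?add0n //.
by rewrite size_map size_lists.
Qed.

Lemma nth_lists (u : 'I_n) : nth [::] lists u = map val (adj u).
Proof. by rewrite (nth_map u) ?size_enum_ord // nth_ord_enum. Qed.

Lemma input_offS (u : 'I_n) : off u.+1 = off u + size (adj u).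
Proof.
rewrite !input_off ?(ltnW (ltn_ord u)) //.
have lt_u : u < size lists by rewrite size_lists.
rewrite (take_nth 0) ?(size_map _ lists) // -cats1 sumn_cat /= addn0.
by rewrite (nth_map [::]) // nth_lists size_map.
Qed.

Lemma input_cell (u : 'I_n) i : i < size (adj u) ->
  A (off u + i) = nth 0 (map val (adj u)) i.
Proof.
move=> lt_i; rewrite /A /= -/lists.
have lt_u : u < size lists by rewrite size_lists.
rewrite -[in LHS](cat_take_drop u lists) (drop_nth [::]) // flatten_cat /=.
rewrite input_off ?(ltnW (ltn_ord u)) // -map_take -/(shape _) -size_flatten.
by rewrite nth_cat ltnNge leq_addr /= addKn nth_cat nth_lists size_map lt_i.
Qed.

Lemma input_graph : nat_graph n nat_rel off A.
Proof.
have [e_sym e_irr] := e_simple; have [/card_gt0P[u0 _] econ] := e_conn.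
have n0 : 0 < n := leq_ltn_trans (leq0n _) (ltn_ord u0).
split.
- by move=> x y /nat_rel_ex[u [v [-> -> _]]]; split; apply: ltn_ord.
- move=> x y; apply/idP/idP => /nat_rel_ex[u [v [-> -> euv]]];
    by rewrite nat_relP e_sym.
- move=> x; apply/negbTE/negP=> h; have [u [v [xu xv euv]]] := nat_rel_ex h.
  have uv : u = v by apply: val_inj; rewrite -xu.
  by rewrite uv e_irr in euv.
- move=> y yn; have /connectP[p pp ly] := econ (Ordinal n0) (Ordinal yn).
  exists (map val p); first exact: (path_nat pp).
  by rewrite (last_map val p (Ordinal n0)) -ly.
- by move=> x xn; rewrite (input_offS (Ordinal xn)) leq_addr.
- by rewrite input_off ?take0.
- move=> x k xn; rewrite (input_offS (Ordinal xn)) => /andP[ok].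
  rewrite -(subnKC ok) ltn_add2l => lt_k; rewrite (input_cell (u := Ordinal xn)) //.
  set u := Ordinal xn; rewrite (nth_map u) //.
  by rewrite (nat_relP u) -(proj2 (adjP u)) mem_nth.
- move=> x y /nat_rel_ex[u [v [-> -> euv]]].
  have v_u : v \in adj u by rewrite (proj2 (adjP u)).
  exists (off u + index v (adj u)).
    by rewrite leq_addr input_offS ltn_add2l index_mem.
  by rewrite input_cell ?index_mem // (nth_map u) ?index_mem // nth_index.
Qed.

Lemma input_size : off n = \sum_(u : 'I_n) #|[pred v | e u v]|.
Proof.
have main k : k <= n -> off k = \sum_(u : 'I_n | u < k) #|[pred v | e u v]|.
  elim: k => [|k IH] kn; first by rewrite input_off // take0 big_pred0.
  rewrite (input_offS (Ordinal kn)) /= IH ?(ltnW kn) //.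
  rewrite [RHS](bigD1 (Ordinal kn)) //= addnC; congr (_ + _).
    have [ua mem_a] := adjP (Ordinal kn); rewrite -(card_uniqP ua).
    by apply: eq_card => v; rewrite mem_a.
  apply: eq_bigl => u; rewrite -(inj_eq val_inj) /= ltnS ltn_neqAle andbC.
  by [].
by rewrite main //; apply: eq_bigl => u; rewrite ltn_ord.
Qed.

Lemma input_size_le : off n <= 2 * graph_size e.
Proof. by rewrite input_size (degree_sum e_simple (h := @nat_of_ord n)) //; apply: val_inj. Qed.

(** This crude bound is enough to fix the word size, since indices into array 1 reach [off n]. *)
Lemma input_size_sqr : off n <= n * n.
Proof.
rewrite input_size -[leqRHS]mul1n; apply: leq_trans (leq_sum _ (E2 := fun=> n) _) _.
  by move=> u _; rewrite -[leqRHS](card_ord n) max_card.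
by rewrite sum_nat_const card_ord mul1n.
Qed.

Lemma input_size_ge : 1 < n -> n <= off n.
Proof.
move=> n1; rewrite input_size -[leqLHS](card_ord n) -sum1_card.
apply: leq_sum => u _; have [_ econ] := e_conn.
have [v uv] : exists v, v != u.
  have [E|ne] := eqVneq u (Ordinal n1); last by exists (Ordinal n1); rewrite eq_sym.
  by exists (Ordinal (ltnW n1)); rewrite E.
have /connectP[[|w p] /= pp lp] := econ u v.
  by rewrite lp eqxx in uv.
by apply/card_gt0P; exists w; rewrite inE; case/andP: pp.
Qed.

End Input.

(** * From numbers to vertices *)

Section Transport.
Variables (n : nat) (e : rel 'I_n).
Hypotheses (e_simple : simple_graph e) (e_conn : connected_graph e).
Hypothesis n_gt0 : 0 < n.

Let en := nat_rel e.
Let r : 'I_n := Ordinal n_gt0.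

Section Layers.
Variables (lev par : nat -> nat).
Hypothesis par_en : forall x, x < n -> x <> 0 -> en x (par x) /\ lev x = (lev (par x)).+1.
Hypothesis lip : forall x y, en x y -> lev y <= (lev x).+1.

(** Out of range values go to the root. The parent maps are in range at every vertex other than the
    root, where alone they are read as parents. *)
Definition ord_fun (f : nat -> nat) (u : 'I_n) : 'I_n := insubd r (f (val u)).

Lemma ord_funE f u : f (val u) < n -> val (ord_fun f u) = f (val u).
Proof. by move=> lt; rewrite /ord_fun val_insubd lt. Qed.

Lemma neq_root (u : 'I_n) : u != r -> val u <> 0.
Proof. by move=> /eqP ur u0; apply: ur; apply: val_inj. Qed.

Lemma ord_par (u : 'I_n) : val u <> 0 ->
  [/\ val (ord_fun par u) = par (val u), e u (ord_fun par u) &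
      lev (val u) = (lev (val (ord_fun par u))).+1].
Proof.
move=> u0; have [eup lup] := par_en (ltn_ord u) u0.
have [u' [v [uu' pv euv]]] := nat_rel_ex eup.
have uE : u = u' by apply: val_inj.
have pE : val (ord_fun par u) = par (val u) by rewrite ord_funE // pv ltn_ord.
split=> //; last by rewrite pE.
by rewrite uE in pE *; rewrite (_ : ord_fun par u' = v) //; apply: val_inj; rewrite pE -uE.
Qed.

Lemma layer_diameter x y : x < n -> y < n -> lev x = lev y ->
    conn en lev (lev x) x y ->
  exists p, [/\ path en x p, last x p = y & size p <= 6 * tree_breadth e].
Proof.
move=> xn yn lxy [p /andP[_ pp] lp].
(* The minimum is attained, which supplies a decomposition for [cluster_walk]. *)
rewrite /tree_breadth; case: ex_minnP => b /asboolP[I [tr [X [decX <-]]]] _.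
pose u : 'I_n := Ordinal xn; pose v : 'I_n := Ordinal yn.
have parP (a : 'I_n) : a != r ->
    e a (ord_fun par a) && (lev (val a) == (lev (val (ord_fun par a))).+1).
  by move=> /neq_root/ord_par[_ -> ->]; rewrite eqxx.
have lipP (a c : 'I_n) : e a c -> lev (val c) <= (lev (val a)).+1.
  by move=> eab; apply: lip; rewrite /en nat_relP.
have [q qE pq] : exists2 q : seq 'I_n, p = map val q & path e u q.
  by apply: nat_path; apply: sub_path pp => a c /and3P[].
have cuv : connect (within e (fun a : 'I_n => lev (val u) <= lev (val a))) u v.
  apply/connectP; exists q; last first.
    by apply: val_inj; rewrite -(last_map val q u) -qE lp.
  move: pp; rewrite qE -[x]/(val u) path_map; apply: sub_path => a c.
  by rewrite /within /= /en nat_relP.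
have [p' [pp' lp' sp']] := cluster_walk e_simple e_conn decX parP lipP (u := u) (v := v) lxy cuv.
exists (map val p'); split; first exact: (path_nat pp').
  by rewrite -[x]/(val u) last_map lp'.
by rewrite size_map.
Qed.

End Layers.

(** * The second search tree is a spanner *)

Section Spanner.
Variables (lev par fp : nat -> nat) (Q D V P : nat -> nat) (s : state) (K : nat).
Hypothesis par_en : forall x, x < n -> x <> 0 -> en x (par x) /\ lev x = (lev (par x)).+1.
Hypothesis lip : forall x y, en x y -> lev y <= (lev x).+1.
Hypothesis fpP : forall y, y < n -> fp y <> 0 -> fp y = (par y).+1 /\ y <> 0.
Hypothesis fp_uniq : forall x y, x < n -> y < n -> fp x <> 0 -> fp y <> 0 ->
  lev x = lev y -> conn en lev (lev x) x y -> x = y.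
Hypothesis fp_walk : forall x, x < n -> walk en fp K x 0.
Variables (off A : nat -> nat).
Hypothesis gr : nat_graph n en off A.
Hypothesis tree : bfs_inv n en (zero_edge fp) n n n Q D V P (arr s 2) (arr s 3).

Let e_sym : symmetric e. Proof. by case: e_simple. Qed.
Let P' := ord_fun P.
Let nonfree : 'I_n -> 'I_n -> nat := indic (fun u v : 'I_n => ~~ zero_edge fp (val u) (val v)).

Let nonfree_sym u v : nonfree u v = nonfree v u.
Proof. by rewrite /nonfree /indic /zero_edge orbC. Qed.

Lemma queue_pos (u : 'I_n) : exists2 k, k < n & Q k = val u.
Proof. by have [_ h] := bfs_inv_done gr tree; apply: h; apply: ltn_ord. Qed.

(** Queue positions are the heights given to [parent_tree]; distances would not do, since they are
    constant along edges of length 0. *)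
Definition pos (u : 'I_n) := index (val u) (map Q (iota 0 n)).

Lemma posE (u : 'I_n) k : k < n -> Q k = val u -> pos u = k.
Proof.
move=> kn Qk; have [us _] := bfs_inv_uniq tree.
rewrite /pos -Qk -{1}[k](nth_iota 0 0 kn) -(nth_map 0 0) ?size_iota //.
by rewrite index_uniq // size_map size_iota.
Qed.

Lemma tree_parent (u : 'I_n) : u != r ->
  [/\ val (P' u) = P (val u), e (P' u) u, pos (P' u) < pos u &
      D (val u) = D (val (P' u)) + nonfree (P' u) u].
Proof.
move=> /neq_root u0; have [k kn Qk] := queue_pos u.
have k0 : 0 < k by case: k Qk {kn} => // Q0; rewrite -Q0 (b_Q0 tree) in u0.
have [|k' [lt_k PQ eQ DQ]] := b_P tree (k := k); first by rewrite k0.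
have k'n := ltn_trans lt_k kn; have Q'n := b_Qlt tree k'n.
have pE : val (P' u) = P (val u) by rewrite ord_funE // -Qk PQ.
have pQ : val (P' u) = Q k' by rewrite pE -Qk PQ.
split=> //.
- by move: eQ; rewrite Qk -pQ /en nat_relP.
- by rewrite (posE kn Qk) (posE k'n (esym pQ)).
- by rewrite -Qk DQ /nonfree /indic pQ Qk.
Qed.

Let S := parent_graph r P'.

Lemma output_tree : output_graph s = S.
Proof.
apply/funext=> u; apply/funext=> v.
have main (a b : 'I_n) : ((val a, val b) \in [seq (arr s 2 i, arr s 3 i) | i <- iota 0 n.-1])
    = (a != r) && (P' a == b).
  apply/mapP/andP=> [[i]|[ar /eqP <-]].
    rewrite mem_iota add0n => lt_i [aE bE].
    have [aE' bE'] : val a = arr s 2 i /\ val b = arr s 3 i by [].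
    (* Output cell [i] describes queue entry [i.+1], because the root has no parent edge. *)
    have iS : 0 < i.+1 < n by rewrite /= -ltn_predRL.
    have [O2 O3] := b_O tree iS; rewrite /= in O2 O3.
    have ar : a != r.
      apply/eqP=> E; have := b_Qinj tree (k := i.+1) (k' := 0).
      rewrite (b_Q0 tree) -O2 -aE' E => /(_ (proj2 (andP iS)) n_gt0 erefl) //.
    split=> //; have [pE _ _ _] := tree_parent ar.
    by apply/eqP/val_inj; rewrite pE bE' O3 -O2 -aE'.
  have [pE _ _ _] := tree_parent ar; have [k kn Qk] := queue_pos a.
  have k0 : 0 < k.
    case: k Qk {kn} => // Q0; move/neq_root: ar; by rewrite -Q0 (b_Q0 tree).
  have [|O2 O3] := b_O tree (k := k); first by rewrite k0.
  exists k.-1; first by rewrite mem_iota add0n ltn_predRL prednK.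
  by rewrite O2 O3 Qk pE.
by rewrite /output_graph /S /parent_graph !main.
Qed.

Lemma spanner_sub : subrel S e.
Proof.
move=> u v /orP[] /andP[/tree_parent[_ ep _ _] /eqP <-] //.
by rewrite e_sym.
Qed.

Lemma spanner_root_walk (u : 'I_n) : exists p,
  [/\ path S u p, last u p = r & esum nonfree u p <= K].
Proof.
have Dle x y p : path en x p -> last x p = y ->
    D x <= esum (indic (fun a b => ~~ zero_edge fp a b)) x p + D y.
  elim: p x => [|z p IH] x /=; first by move=> _ ->.
  case/andP=> exz /IH{IH} h /h{h} le_z.
  rewrite (en_sym gr) in exz; have := bfs_inv_lip gr tree exz.
  rewrite /indic in le_z *; rewrite /zero_edge orbC -/(zero_edge fp x z) => le_x.
  by apply: leq_trans le_x _; rewrite addnC -addnA leq_add2l.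
have DK x : x < n -> D x <= K.
  move=> /fp_walk[p [pp lp sp]]; apply: leq_trans (Dle _ _ _ pp lp) _.
  by rewrite (b_D0 tree) addn0.
suff main m : forall a : 'I_n, pos a < m -> exists p,
    [/\ path S a p, last a p = r & esum nonfree a p <= D (val a)].
  have [p [pp lp sp]] := main _ u (leqnn _).
  by exists p; split=> //; apply: leq_trans sp (DK _ (ltn_ord u)).
elim: m => // m IH a lt_m.
have [->|ar] := eqVneq a r; first by exists [::].
have [_ _ lt_p DE] := tree_parent ar.
have [|p [pp lp sp]] := IH (P' a); first exact: leq_trans lt_p lt_m.
exists (P' a :: p); rewrite /= pp lp /S /parent_graph ar eqxx; split=> //.
by rewrite DE nonfree_sym addnC leq_add2r.
Qed.

Lemma spanner : additive_tree_spanner e (output_graph s) (4 * K).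
Proof.
rewrite output_tree; have S_tree : is_tree S.
  by apply: (parent_tree (h := pos)) => u /tree_parent[].
split=> //; first exact: spanner_sub.
move=> u v; have [p [pp lp sp]] := spanner_root_walk u.
have [q0 [pq0 lq0 sq0]] := spanner_root_walk v.
have S_sym : symmetric S by case: S_tree => -[].
have [q []] := sym_walk_esum S_sym nonfree_sym pq0; rewrite lq0 => pq lq sq.
(* The two walks to the root, concatenated and made simple, have at most [2 * K] non-free edges;
   [free_path_size] doubles this to [4 * K]. *)
have [t [pt lt ut st]] : exists t, [/\ path S u t, last u t = v, uniq (u :: t)
    & esum nonfree u t <= 2 * K].
  have ppq : path S u (p ++ q) by rewrite cat_path pp lp.
  have [t [pt lt ut st]] := uniq_walk nonfree ppq.
  exists t; rewrite lt last_cat lp lq; split=> //.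
  apply: leq_trans st _; rewrite esum_cat lp sq mul2n -addnn.
  exact: leq_add.
have [_ econ] := e_conn.
have [d0 [pd0 ld0 sd0]] := dist_walk (econ u v).
have [d []] := sym_walk e_sym pd0; rewrite ld0 => pd ld sd.
have pte := sub_path spanner_sub pt.
pose F (a : 'I_n) := fp (val a) != 0.
have FP (a : 'I_n) : F a -> val a <> 0 /\ fp (val a) = (val (ord_fun par a)).+1.
  move=> /eqP/(fpP (ltn_ord a))[E a0]; have [pE _ _] := ord_par par_en a0.
  by rewrite pE.
have le_t : size t <= size d + 2 * esum (indic (fun a b => ~~ free (ord_fun par) F a b)) u t.
  rewrite -lt in pd ld.
  apply: (@free_path_size _ e (fun a => lev (val a)) (ord_fun par) F) pte ut pd _ => //.
  - by move=> a b eab; apply: lip; rewrite /en nat_relP.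
  - by move=> a /FP[a0 _]; have [_ ? ?] := ord_par par_en a0.
  - move=> a b Fa Fb lab /connectP[w pw lw]; apply: val_inj.
    apply: fp_uniq lab _; [exact: ltn_ord|exact: ltn_ord|exact/eqP|exact/eqP|].
    exists (map val w); last by rewrite last_map lw.
    rewrite leqnn path_map; apply: sub_path pw => c c'.
    by rewrite /above /within /= /en nat_relP.
have free_zr a b : free (ord_fun par) F a b = zero_edge fp (val a) (val b).
  have half (x y : 'I_n) : F x && (ord_fun par x == y) = (fp (val x) == (val y).+1).
    rewrite -(inj_eq val_inj); case Fx: (F x).
      by have [_ ->] := FP x Fx; rewrite eqSS.
    by move/negbFE/eqP: Fx => ->.
  by rewrite /free !half /zero_edge orbC.
have E : esum (indic (fun a b => ~~ free (ord_fun par) F a b)) u t = esum nonfree u t.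
  apply/eqP; rewrite eqn_leq !(leq_esum (e := e)) // => a b _;
    by rewrite /nonfree /indic free_zr.
rewrite E sd sd0 in le_t.
have := dist_le pt; rewrite lt => /leq_trans; apply.
apply: leq_trans le_t _; rewrite leq_add2l.
by rewrite (leq_trans (leq_mul (leqnn 2) st)) // mulnA.
Qed.

End Spanner.
End Transport.

(** * The main theorem *)

Definition spanner_cmd : cmd := Seq bfs (Seq uf bfs).

(** [5 * (trunc_log 2 n).+1] bits exceed any number below [n.+1 ^ 5]; two factors [n.+1] cover the
    quadratic bound on [off n], the other three the small constants. *)
Lemma word_size n w : 0 < n -> 5 * (trunc_log 2 n).+1 <= w -> n * n + n + 3 < 2 ^ w.
Proof.
move=> n0 le_w; apply: leq_trans (_ : 2 ^ (5 * (trunc_log 2 n).+1) <= _); last first.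
  by rewrite leq_exp2l.
have := trunc_log_ltn n (isT : 1 < 2); rewrite mulnC expnM => nB.
apply: leq_trans (_ : n.+1 ^ 5 <= _); last by rewrite leq_exp2r.
apply: leq_trans (_ : n.+1 ^ 2 * 2 <= _).
  by move: n0; clear; rewrite -mulnn mulSn mulnS; nia.
rewrite (expnD _ 2 3) leq_mul2l orbC; apply/orP; left.
by apply: leq_trans (leq_pexp2l _ (_ : 1 <= 3)) => //; rewrite expn1.
Qed.

Lemma spanner_cmd_exec n (e : rel 'I_n) (adj : 'I_n -> seq 'I_n) w :
    simple_graph e -> connected_graph e -> adjacency_lists e adj ->
    n * n + n + 3 < 2 ^ w ->
  exists t s, [/\ exec w spanner_cmd (input_state adj) t s,
    t <= 440 * (n + arr (input_state adj) 0 n)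
         + (24 * trunc_log 2 n + 150) * arr (input_state adj) 0 n + 100 * n + 100 &
    additive_tree_spanner e (output_graph s)
      (4 * (6 * tree_breadth e * trunc_log 2 n))].
Proof.
move=> e_simple e_conn adjP; set M := n * n + n + 3 => M_lt.
have n_gt0 : 0 < n by have [] := e_conn; rewrite card_ord.
set off := arr (input_state adj) 0; set A := arr (input_state adj) 1.
have gr : nat_graph n (nat_rel e) off A := input_graph e_simple e_conn adjP.
have off_le := input_size_sqr adjP; rewrite -/off in off_le.
have off_M : off n < M by rewrite /M; nlia.
have n_M : n + 3 <= M by rewrite /M; nlia.
pose fp0 : nat -> nat := fun=> 0.
have kept0 : input_kept n off A fp0 (input_state adj) by [].
suff [t [s [ex [t_le sp]]]] : wp w spanner_cmd (input_state adj) (fun t s =>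
  t <= 440 * (n + off n) + (24 * trunc_log 2 n + 150) * off n + 100 * n + 100 /\
  additive_tree_spanner e (output_graph s) (4 * (6 * tree_breadth e * trunc_log 2 n))).
  by exists t, s.
apply: wp_seq.
apply: wp_mono (bfs_wp M_lt n_gt0 gr n_M off_M kept0 _) _ => // t1 s1 [[n1 o1 A1 f1] b1 t1_le].
set Q := arr s1 4 in b1; set lev := arr s1 5 in b1; set par := arr s1 7 in b1.
have [_ Q_surj] := bfs_inv_done gr b1.
have lev0 : lev 0 = 0 := b_D0 b1.
(* With [fp0] no edge has length 0, so the distances of the first search are levels. *)
have lip x y : nat_rel e x y -> lev y <= (lev x).+1.
  by move=> /(bfs_inv_lip gr b1); rewrite addn1.
have par_en x : x < n -> x <> 0 -> nat_rel e x (par x) /\ lev x = (lev (par x)).+1.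
  move=> /Q_surj[k kn Qk] x0; have k0 : 0 < k.
    by case: k Qk {kn} => // Qk; rewrite -Qk (b_Q0 b1) in x0.
  have [|k' [_ PQ eQ DQ]] := b_P b1 (k := k); first by rewrite k0.
  by rewrite -Qk PQ DQ (en_sym gr) addn1.
have fx1 : uf_fixed n off A Q lev par s1 by split.
have V1 x : x < n -> arr s1 6 x <> 0.
  by move=> xn; apply/(b_V b1 xn); have [k kn Qk] := Q_surj x xn; exists k.
have fp1 x : arr s1 8 x = 0 by rewrite f1.
have close := layer_diameter e_simple e_conn n_gt0 par_en lip.
have := uf_wp M_lt n_gt0 gr n_M off_M lev0 par_en close (b_Qlt b1) (b_Qinj b1)
  Q_surj (b_sorted b1) fx1 fp1 V1.
move=> uf_run; apply: wp_seq; apply: wp_mono uf_run _ => t2 s2.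
move=> [[n2 o2 A2 _ _] V2 t2_le fp_walk [fpP fp_uniq]].
have kept2 : input_kept n off A (arr s2 8) s2 by split.
apply: wp_mono (bfs_wp M_lt n_gt0 gr n_M off_M kept2 V2) _ => t3 s3 [_ b3 t3_le].
split; last exact: (spanner e_simple e_conn n_gt0 par_en lip fpP fp_uniq fp_walk gr b3).
by nlia.
Qed.

Theorem corollary2 :
  exists (P : cmd) (C : nat),
  forall (n : nat) (e : rel 'I_n) (adj : 'I_n -> seq 'I_n),
    simple_graph e -> connected_graph e -> adjacency_lists e adj ->
    exists (t : nat) (s : state),
      [/\ exec (C * (trunc_log 2 n).+1) P (input_state adj) t s,
          t <= C * (graph_size e * trunc_log 2 n).+1
        & additive_tree_spanner e (output_graph s)
            (C * (tree_breadth e * trunc_log 2 n))].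
Proof.
(* Keeping [C] abstract avoids computing with the literal. 3000 absorbs the time constants: about
   2300 once [n] and [off n] are replaced by twice the number of edges, plus 100. *)
have [C C_ge] : exists C, 3000 <= C by exists 3000.
exists spanner_cmd, C => n e adj e_simple e_conn adjP.
have n_gt0 : 0 < n by have [] := e_conn; rewrite card_ord.
have C5 : 5 <= C by apply: leq_trans C_ge.
have C24 : 24 <= C by apply: leq_trans C_ge.
have [t [s [ex t_le [tr sub sp]]]] := spanner_cmd_exec e_simple e_conn adjP
  (word_size n_gt0 (leq_mul C5 (leqnn (trunc_log 2 n).+1))).
exists t, s; split=> //.
  apply: leq_trans t_le _; apply: leq_trans (leq_mul C_ge (leqnn _)).
  have off_le := input_size_le e_simple adjP; have off_sqr := input_size_sqr adjP.
  have off_ge := input_size_ge e_conn adjP.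
  set m := graph_size e in off_le *; set off := arr (input_state adj) 0 n in off_le off_sqr off_ge *.
  (* For one vertex the logarithm is 0 and the successor in the time bound pays for everything;
     otherwise the logarithm is positive and connectedness bounds [n] by [off n]. *)
  have [n1|n1] := leqP n 1.
    have nE : n = 1 by apply/eqP; rewrite eqn_leq n1.
    rewrite nE in off_sqr *; rewrite (_ : trunc_log 2 1 = 0) //; nlia.
  have L1 : 0 < trunc_log 2 n by rewrite trunc_log_gt0.
  have n_le := leq_trans (off_ge n1) off_le.
  have mL : m <= m * trunc_log 2 n by rewrite leq_pmulr.
  have offL : trunc_log 2 n * off <= trunc_log 2 n * (2 * m) by rewrite leq_mul.
  rewrite mulnDl -mulnA.
  move: offL; rewrite mulnCA (mulnC _ m).
  move: (m * _) (trunc_log 2 n * off) mL n_le off_le => X Y; nlia.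
split=> // u v; apply: leq_trans (sp u v) _; rewrite leq_add2l !mulnA.
by rewrite leq_mul // leq_mul.
Qed.
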